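(* Let $p$ be a prime, let $U$ be a uniform pro-$p$ group, and let $G$ be a (not necessarily closed) subgroup of $U$. If $G$ is virtually solvable, then the Fitting subgroup $\operatorname{Fitt}(G)$ is nilpotent and $G/\operatorname{Fitt}(G)$ is torsion-free abelian.
   Context: A pro-$p$ group $U$ is powerful if $U/\overline{U^p}$ is abelian (for $p$ odd), respectively $U/\overline{U^4}$ is abelian (for $p=2$), where $\overline{U^k}$ is the closure of the subgroup generated by $k$-th powers. A pro-$p$ group $U$ is uniform if it is topologically finitely generated, powerful, and $|P_i(U):P_{i+1}(U)| = |U:P_2(U)|$ for all $i \ge 1$, where $P_1(U)=U$ and $P_{i+1}(U)=\overline{P_i(U)^p[P_i(U),U]}$. (Equivalently: $U$ is topologically finitely generated, powerful and torsion free.) A group is virtually solvable if it has a solvable subgroup of finite index. The Fitting subgroup $\operatorname{Fitt}(G)$ is the subgroup of $G$ generated by all nilpotent normal subgroups of $G$. *)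

(* Defs.v *)
From HB Require Import structures.
From mathcomp Require Import all_boot.
From mathcomp Require Import boolp classical_sets functions cardinality topology.

Set Implicit Arguments.
Unset Strict Implicit.
Unset Printing Implicit Defensive.

Local Open Scope classical_set_scope.
Local Open Scope card_scope.
Local Open Scope group_scope.

HB.mixin Record Topological_isTopologicalGroup G of Topological G & Group G := {
  mulg_continuous : continuous (fun x : G * G => x.1 * x.2) ;
  invg_continuous : continuous (fun x : G => x^-1)
}.

#[short(type="topologicalGroupType")]
HB.structure Definition TopologicalGroup :=
  {G of Topological_isTopologicalGroup G & Topological G & Group G}.

(* Subgroups are subsets of an ambient, possibly infinite, group T. *)
Section AbstractGroups.
Variable T : groupType.
Implicit Types A B G H N : set T.

Definition is_subgroup H : Prop := group_closed (mem H).

Definition generated A : set T := smallest is_subgroup A.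

Definition is_normal_in N G : Prop :=
  [/\ is_subgroup N, N `<=` G & forall x g, N x -> G g -> N (x ^ g)].

Definition mulgs A B : set T := [set x * y | x in A & y in B].

Definition commgs A B : set T := generated [set [~ x, y] | x in A & y in B].

Definition powers H k : set T := generated [set x ^+ k | x in H].

Definition cosets G H : set (set T) := [set mulgs [set x] H | x in G].

(* For N normal in G, the group G / N is the set of cosets with the setwise
   product; its identity element is N, whence the base case of the power. *)
Definition quotient_abelian G N : Prop :=
  forall A B, cosets G N A -> cosets G N B -> mulgs A B = mulgs B A.

Definition quotient_torsion_free G N : Prop :=
  forall A n, cosets G N A -> (0 < n)%N -> iter n (mulgs A) N = N -> A = N.

Fixpoint derived_series G n : set T :=
  if n is m.+1 then commgs (derived_series G m) (derived_series G m) else G.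

Fixpoint lower_central_series G n : set T :=
  if n is m.+1 then commgs (lower_central_series G m) G else G.

Definition is_solvable G : Prop := exists n, derived_series G n = [set 1].

Definition is_nilpotent G : Prop := exists n, lower_central_series G n = [set 1].

Definition virtually_solvable G : Prop :=
  exists H, [/\ is_subgroup H, H `<=` G, is_solvable H & finite_set (cosets G H)].

Definition Fitting G : set T :=
  generated (\bigcup_(N in [set N | is_normal_in N G /\ is_nilpotent N]) N).

End AbstractGroups.

Section ProPGroups.
Variables (p : nat) (U : topologicalGroupType).

(* A profinite group is a compact Hausdorff topological group whose open
   subgroups form a base of neighbourhoods of 1; it is pro-p when moreover all
   its open normal subgroups have index a power of p. *)
Definition is_profinite : Prop :=
  [/\ compact [set: U], hausdorff_space U &
      forall V : set U, nbhs (1 : U) V ->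
        exists H : set U, [/\ is_subgroup H, open H & H `<=` V]].

Definition is_pro_p : Prop :=
  is_profinite /\
  forall N : set U, is_normal_in N [set: U] -> open N ->
    exists k : nat, cosets [set: U] N #= `I_(p ^ k)%N.

Definition topologically_fg : Prop :=
  exists2 A : set U, finite_set A & closure (generated A) = [set: U].

Definition is_powerful : Prop :=
  quotient_abelian [set: U]
    (closure (powers [set: U] (if p == 2 then 4 else p))).

(* Indexed from 0: the i-th term is the one usually written P_{i+1}(U). *)
Fixpoint lower_p_series (i : nat) : set U :=
  if i is j.+1 then
    closure (mulgs (powers (lower_p_series j) p)
                   (commgs (lower_p_series j) [set: U]))
  else [set: U].

(* The equality of indices is an equality of cardinals of coset spaces. *)
Definition is_uniform_pro_p : Prop :=
  [/\ is_pro_p, topologically_fg, is_powerful &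
      forall i : nat,
        cosets (lower_p_series i) (lower_p_series i.+1) #=
        cosets [set: U] (lower_p_series 1)].

End ProPGroups.

Arguments lower_p_series p U i : clear implicits.

(* Main.v *)
(* The lower p-series P of U satisfies [P i, P j] <= P (i + j + 1) (one step
   deeper if p = 2), and x |-> x ^ p induces isomorphisms P i / P (i + 1) ->
   P (i + 1) / P (i + 2). Hence P n / P (2 n) is isomorphic to (Z / p ^ n) ^ d,
   and the classes of x ^ (p ^ n) there define an injective map
   L : U -> Z_p ^ d with L (x ^ g) = L x * A g, where A is multiplicative and
   A g is congruent to 1 modulo q, with q = p if p is odd and q = 4 if p = 2.

   The eigenvalues of the A g then have the form 1 + q x with x integral over
   Z_p, and a ^ n = b ^ n with n > 0 forces a = b for such elements. As in the
   Lie-Kolchin theorem this makes A, restricted to the span of L G, triangular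
   over an extension of Q_p: a line stable under g ^ n is stable under g, so
   passing to a subgroup of finite index costs nothing, and the characters of a
   commuting normal subset are fixed, not just permuted, by G.

   Let F be the set of g in G whose triangular matrix has diagonal 1. Then F is
   normal and nilpotent, and G / F embeds in a group of diagonal matrices, in
   which roots are unique. Conversely, if N is normal and nilpotent, then
   L (y * m) - L y lies in the span of L M for every m in a normal subgroup M of
   G, so A x - 1 maps the span of the logarithms of each term of the lower
   central series of N into that of the next one; thus A x is unipotent for x in
   N, and N <= F. Hence F is the Fitting subgroup. *)

From HB Require Import structures.
From mathcomp Require Import all_boot all_algebra fieldext finmap.
From mathcomp Require fingroup morphism quotient cyclic pgroup center nilpotent sylow.
From mathcomp Require Import boolp classical_sets cardinality topology.
From mathcomp Require Import zify ring.
Require Import Defs.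

Set Implicit Arguments.
Unset Strict Implicit.
Unset Printing Implicit Defensive.

Local Open Scope classical_set_scope.
Local Open Scope card_scope.
Local Open Scope group_scope.

(** * Subgroups and quotients of abstract groups *)

(** The map L is not additive on G, and G need not be closed; the obstacle is to compare logarithms
    without leaving G. One congruence does it: [p ^ n *: (L x - L y)] agrees with the logarithm of
    [x ^ (p ^ n) * (y ^ (p ^ n))^-1] modulo [p ^ (2 n)]. As n grows, it forces [L x - L y] into
    every subspace that contains the logarithms of all these quotients of powers. The constant q is
    4 for p = 2 because 1 and -1 are congruent modulo 2 and have the same square, so roots are not
    unique among the elements congruent to 1 modulo 2. Eigenvalues are obtained by adjoining one
    root at a time, so the statements on representations quantify over embeddings of fields. Vectors
    are rows and matrices act on the right: triangular means lower triangular, and a stable line is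
    put first in the basis. *)

Section Subgroups.
Variable T : groupType.
Implicit Types (A B G H K N M : set T) (x y : T).

Lemma is_subgroupP H :
  is_subgroup H <-> H 1 /\ forall x y, H x -> H y -> H (x / y).
Proof.
split=> [[H1 HB]|[H1 HB]]; split.
- by have := H1; rewrite inE.
- by move=> x y Hx Hy; have := HB x y; rewrite !inE; apply.
- by rewrite inE.
- by move=> x y; rewrite !inE; apply: HB.
Qed.

Lemma subgroup1 H : is_subgroup H -> H 1.
Proof. by move/is_subgroupP=> []. Qed.

Lemma subgroupV H x : is_subgroup H -> H x -> H x^-1.
Proof. by move/is_subgroupP=> [H1 HB] Hx; rewrite -div1g; apply: HB. Qed.

Lemma subgroupM H x y : is_subgroup H -> H x -> H y -> H (x * y).
Proof.
move=> sH Hx Hy; rewrite -[y]invgK; have [_ HB] := (is_subgroupP H).1 sH.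
by apply: HB => //; apply: subgroupV.
Qed.

Lemma subgroupX H x n : is_subgroup H -> H x -> H (x ^+ n).
Proof.
move=> sH Hx; elim: n => [|n IHn]; first exact: subgroup1.
by rewrite expgS; apply: subgroupM.
Qed.

Lemma subgroupJ H x y : is_subgroup H -> H x -> H y -> H (x ^ y).
Proof. by move=> sH Hx Hy; rewrite conjgE; do !apply: subgroupM => //; apply: subgroupV. Qed.

Lemma subgroupR H x y : is_subgroup H -> H x -> H y -> H [~ x, y].
Proof. by move=> sH Hx Hy; rewrite commgEl; apply: subgroupM (subgroupV _ _) (subgroupJ _ _ _). Qed.

Lemma sub_generated A : A `<=` generated A.
Proof. exact: sub_smallest. Qed.

Lemma generated_subgroup A : is_subgroup (generated A).
Proof.
apply/is_subgroupP; split; first by move=> H [sH _]; apply: subgroup1.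
by move=> x y Ax Ay H HA; have [_] := (is_subgroupP H).1 HA.1; apply; [apply: Ax|apply: Ay].
Qed.

Lemma generated_min A H : is_subgroup H -> A `<=` H -> generated A `<=` H.
Proof. by move=> sH AH; apply: smallest_sub. Qed.

Lemma subgroupT : is_subgroup [set: T].
Proof. by apply/is_subgroupP. Qed.

Lemma conj_preimage_subgroup H y : is_subgroup H -> is_subgroup [set x | H (x ^ y)].
Proof.
move=> sH; apply/is_subgroupP; split; first by rewrite /= conj1g; apply: subgroup1.
by move=> a b /= Ha Hb; rewrite conjMg conjVg; apply: subgroupM => //; apply: subgroupV.
Qed.

Lemma generated_normalised A y :
  (forall x, A x -> A (x ^ y)) -> forall x, generated A x -> generated A (x ^ y).
Proof.
move=> AJ; apply: generated_min.
  by apply: conj_preimage_subgroup; apply: generated_subgroup.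
by move=> x Ax; apply: sub_generated; apply: AJ.
Qed.

Lemma mulgs_normal N M : is_normal_in N setT -> is_normal_in M setT ->
  is_normal_in (mulgs N M) setT.
Proof.
move=> [sN _ nN] [sM _ nM]; split=> //.
- apply/is_subgroupP; split.
    by exists 1; [exact: subgroup1|exists 1; [exact: subgroup1|rewrite mulg1]].
  move=> _ _ [a Na [b Mb <-]] [c Nc [d Md <-]].
  exists (a / (c ^ (d / b))).
    by apply: subgroupM => //; apply: subgroupV => //; apply: nN.
  exists (b / d); first by apply: subgroupM => //; apply: subgroupV.
  by rewrite conjgE !invgM !invgK !mulgA !(mulgVK, mulgK).
move=> _ g [a Na [b Mb <-]] _; exists (a ^ g); first exact: nN.
by exists (b ^ g); [apply: nM|rewrite conjMg].
Qed.

Lemma powers_normal H k : is_normal_in H setT -> is_normal_in (powers H k) setT.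
Proof.
move=> [sH _ nH]; split=> //; first exact: generated_subgroup.
move=> x g Hx _; move: x Hx; apply: generated_normalised => _ [y Hy <-].
by exists (y ^ g); [apply: nH|rewrite conjXg].
Qed.

Lemma commgs_normal H K : is_normal_in H setT -> is_normal_in K setT ->
  is_normal_in (commgs H K) setT.
Proof.
move=> [sH _ nH] [sK _ nK]; split=> //; first exact: generated_subgroup.
move=> x g Hx _; move: x Hx; apply: generated_normalised => _ [y Hy [z Kz <-]].
by exists (y ^ g); [apply: nH|exists (z ^ g); [apply: nK|rewrite conjRg]].
Qed.

Lemma commgs_sub H K N : is_subgroup N ->
  (forall x y, H x -> K y -> N [~ x, y]) -> commgs H K `<=` N.
Proof. by move=> sN HKN; apply: generated_min => // _ [x Hx [y Ky <-]]; apply: HKN. Qed.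

Lemma commgs_mem H K x y : H x -> K y -> commgs H K [~ x, y].
Proof. by move=> Hx Ky; apply: sub_generated; exists x => //; exists y. Qed.

End Subgroups.

Lemma preimage_subgroup (T S : groupType) (f : UMagmaMorphism.type T S) (H : set S) :
  is_subgroup H -> is_subgroup (f @^-1` H).
Proof.
move=> sH; apply/is_subgroupP; split; first by rewrite /= gmulf1; exact: (subgroup1 sH).
by move=> x y /= Hx Hy; rewrite gmulfF; have [_] := (is_subgroupP H).1 sH; apply.
Qed.

(** * Quotient groups as types *)

Section Quotient.
Variables (T : groupType) (N : set T).
Hypothesis nN : is_normal_in N setT.

Let sN : is_subgroup N. Proof. by case: nN. Qed.
Let NJ x g : N x -> N (x ^ g). Proof. by case: nN => _ _ nJ Nx; apply: nJ. Qed.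

Definition eqmod (x y : T) : bool := `[< N (x^-1 * y) >].

Lemma eqmod_equiv : equiv_class_of eqmod.
Proof.
have esym x y : eqmod x y -> eqmod y x.
  by rewrite /eqmod => /asboolP /(subgroupV sN) h; apply/asboolP; move: h; rewrite invgM invgK.
split=> [x|x y|y x z].
- by rewrite /eqmod mulVg; apply/asboolP; exact: subgroup1.
- by apply/idP/idP; apply: esym.
- move=> /asboolP xy /asboolP yz; apply/asboolP.
  by have := subgroupM sN xy yz; rewrite mulgA mulgK.
Qed.

Canonical eqmod_rel := EquivRelPack eqmod_equiv.

Definition quotient_group := {eq_quot eqmod_rel}%qT.
HB.instance Definition _ := Choice.on quotient_group.

Local Notation pi := (\pi_quotient_group)%qT.

Lemma pi_eqmod x y : (pi x == pi y) = eqmod x y.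
Proof. by rewrite piE. Qed.

Lemma pi_eq x y : N (x^-1 * y) -> pi x = pi y.
Proof. by move=> Nxy; apply/eqP; rewrite pi_eqmod; apply/asboolP. Qed.

Lemma repr_pi x : N (x^-1 * generic_quotient.repr (pi x)).
Proof.
apply/asboolP; rewrite -/(eqmod x _) -pi_eqmod; apply/eqP.
by rewrite generic_quotient.reprK.
Qed.

Definition quotient_mul (a b : quotient_group) : quotient_group :=
  pi (generic_quotient.repr a * generic_quotient.repr b).
Definition quotient_inv (a : quotient_group) : quotient_group :=
  pi (generic_quotient.repr a)^-1.
Definition quotient_one : quotient_group := pi 1.

Lemma pi_mul x y : quotient_mul (pi x) (pi y) = pi (x * y).
Proof.
symmetry; apply: pi_eq.
set x' := generic_quotient.repr _; set y' := generic_quotient.repr _.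
rewrite (_ : (x * y)^-1 * (x' * y') = (x^-1 * x') ^ y * (y^-1 * y')).
  by apply: subgroupM (repr_pi y) => //; apply: NJ; apply: repr_pi.
by rewrite conjgE invgM !mulgA mulgK.
Qed.

Lemma pi_inv x : quotient_inv (pi x) = pi x^-1.
Proof.
symmetry; apply: pi_eq.
set x' := generic_quotient.repr _; rewrite invgK.
rewrite (_ : x * x'^-1 = ((x^-1 * x')^-1) ^ x^-1).
  by apply: NJ; apply: subgroupV => //; exact: repr_pi.
by rewrite conjgE !invgM !invgK !mulgA mulgK.
Qed.

Lemma quotient_ind (P : quotient_group -> Prop) : (forall x, P (pi x)) -> forall a, P a.
Proof. by move=> Ppi a; rewrite -[a]generic_quotient.reprK. Qed.

Lemma quotient_mulA : associative quotient_mul.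
Proof.
elim/quotient_ind=> x; elim/quotient_ind=> y; elim/quotient_ind=> z.
by rewrite !pi_mul mulgA.
Qed.
Lemma quotient_mul1 : left_id quotient_one quotient_mul.
Proof. by elim/quotient_ind=> x; rewrite pi_mul mul1g. Qed.
Lemma quotient_mul1r : right_id quotient_one quotient_mul.
Proof. by elim/quotient_ind=> x; rewrite pi_mul mulg1. Qed.
Lemma quotient_mulV : left_inverse quotient_one quotient_inv quotient_mul.
Proof. by elim/quotient_ind=> x; rewrite pi_inv pi_mul mulVg. Qed.
Lemma quotient_mulVr : right_inverse quotient_one quotient_inv quotient_mul.
Proof. by elim/quotient_ind=> x; rewrite pi_inv pi_mul mulgV. Qed.

HB.instance Definition _ := isGroup.Build quotient_group
  quotient_mulA quotient_mul1 quotient_mul1r quotient_mulV quotient_mulVr.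

Definition quotient_map (x : T) : quotient_group := pi x.
Fact quotient_mapM : {morph quotient_map : x y / x * y}.
Proof. by move=> x y; rewrite /quotient_map -pi_mul. Qed.
HB.instance Definition _ :=
  isUMagmaMorphism.Build T quotient_group quotient_map (erefl, quotient_mapM).

(** Most later arguments see only a surjection [f] with kernel [N]: congruences modulo [N] become
    equations between values of [f]. *)
Lemma quotient_ex : exists (Q : groupType) (f : UMagmaMorphism.type T Q),
  (forall x, f x = 1 <-> N x) /\ (forall a, exists x, a = f x).
Proof.
exists quotient_group, quotient_map; split=> [x|].
  split=> [/eqP|Nx].
    rewrite eq_sym pi_eqmod => /asboolP; by rewrite invg1 mul1g.
  by symmetry; apply: pi_eq; rewrite invg1 mul1g.
by elim/quotient_ind=> x; exists x.
Qed.

End Quotient.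

(** * Commutator calculus in a central filtration *)

Lemma expgM_class2 (Q : groupType) (b z : Q) n :
  commute b [~ z, b] -> commute z [~ z, b] ->
  (b * z) ^+ n = b ^+ n * z ^+ n * [~ z, b] ^+ 'C(n, 2).
Proof.
move=> cb cz; elim: n => [|n IHn]; first by rewrite !expg0 !mulg1.
rewrite expgSr IHn.
set c := [~ z, b] in cb cz IHn *.
have cbz : commute (b * z) (c ^+ 'C(n, 2)).
  by apply: commuteX; apply: commute_sym; apply: commuteM; apply: commute_sym.
rewrite -mulgA -cbz binS bin1 addnC expgnDr !mulgA; congr (_ * _).
(* Moving the next [b] to the left past [z ^+ n] costs [c ^+ n]; these exponents add up to the
   binomial coefficient. *)
have zb : z ^+ n * b = b * z ^+ n * c ^+ n.
  rewrite [LHS]conjgC conjXg -mulgA; congr (_ * _).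
  by rewrite -expgMn // /c commgEl mulVKg.
rewrite -[_ * z ^+ n * b]mulgA zb !mulgA -expgSr -[LHS]mulgA.
rewrite -[X in _ * X = _](commuteX n cz) mulgA; congr (_ * _).
by rewrite -[LHS]mulgA -expgSr.
Qed.

(** The pairs [x], [y] and [x * d], [y * e] have the same central commutator [c]; cancelling [d],
    then [y] and [c], leaves [x * e = e * x]. *)
Lemma commute_of_commg (Q : groupType) (x y d e c : Q) :
  commute c d -> commute c e -> commute d (y * e) ->
  x * y = y * x * c -> x * d * (y * e) = y * e * (x * d) * c -> commute x e.
Proof.
move=> cd ce dye xy; rewrite -mulgA dye -!mulgA -cd !mulgA => /mulIg.
by rewrite xy -[LHS]mulgA ce -!mulgA => /mulgI; rewrite !mulgA => /mulIg.
Qed.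

Section CentralFiltration.
Variables (p : nat) (T : groupType) (P : nat -> set T).
Hypothesis p_pr : prime p.
Hypothesis nP : forall n, is_normal_in (P n) setT.
Hypothesis PX : forall n x, P n x -> P n.+1 (x ^+ p).
Hypothesis PR1 : forall n x u, P n x -> P n.+1 [~ x, u].

(** Modulo [P m.+1] the commutator is central, and it enters with exponent 'C(p, 2). For p odd this
    is a multiple of p; for p = 2 it is 1, whence the extra hypothesis. *)
Lemma filtration_expgM m b z : P m [~ z, b] -> (p = 2 -> P m.+1 [~ z, b]) ->
  P m.+1 (((b * z) ^+ p)^-1 * (b ^+ p * z ^+ p)).
Proof.
move=> Pc P2; have [Q [f [f1 _]]] := quotient_ex (nP m.+1).
apply/f1; rewrite gmulfM gmulfV gmulfXn !gmulfM !gmulfXn.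
have cP y : commute (f y) (f [~ z, b]).
  apply: commute_sym; apply/commgP/eqP.
  by rewrite -gmulfR; apply/f1/PR1.
rewrite expgM_class2 -gmulfR; [|exact: cP|exact: cP].
suff -> : f [~ z, b] ^+ 'C(p, 2) = 1 by rewrite mulg1 mulVg.
have [p2|p_neq2] := eqVneq p 2.
  by rewrite -gmulfXn; apply/f1; apply: subgroupX; [case: (nP m.+1)|apply: P2].
have /dvdnP[k ->] : p %| 'C(p, 2).
  rewrite prime_dvd_bin //= ltn_neqAle eq_sym p_neq2; exact: prime_gt1.
by rewrite mulnC expgnA -[_ ^+ p]gmulfXn ((f1 _).2 (PX Pc)) expg1n.
Qed.

Lemma filtration_congX k a b : P k (a^-1 * b) -> P k.+1 ((a ^+ p)^-1 * b ^+ p).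
Proof.
move=> Pab; have [Q [f [f1 _]]] := quotient_ex (nP k.+1).
have fb : f b = f a * f (a^-1 * b) by rewrite -gmulfM mulVKg.
apply/f1; rewrite gmulfM gmulfV !gmulfXn fb expgMn.
  by rewrite -[f (_ * _) ^+ _]gmulfXn ((f1 _).2 (PX Pab)) mulg1 mulVg.
apply: commute_sym; apply/commgP/eqP; rewrite -gmulfR; exact/f1/PR1.
Qed.

Lemma filtration_commgX m x y : P m [~ x, y] -> P m.+1 [~ x, y ^+ p].
Proof.
move=> Pc; have [Q [f [f1 _]]] := quotient_ex (nP m.+1).
have cP u : commute (f u) (f [~ x, y]).
  apply: commute_sym; apply/commgP/eqP; rewrite -gmulfR; exact/f1/PR1.
have xy : f y ^ f x = f y * (f [~ x, y])^-1.
  by rewrite gmulfR invgR [in RHS]commgEl mulVKg.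
apply/f1; rewrite gmulfR gmulfXn commgEr conjVg conjXg xy expgMn.
  by rewrite expVgn -[f [~ x, y] ^+ p]gmulfXn ((f1 _).2 (PX Pc)) invg1 mulg1 mulVg.
exact: commuteV.
Qed.

(** A form of the three subgroups lemma. Modulo [P m.+2] the commutator [x, y] is central, hence
    equal to its conjugate [x ^ u, y ^ u]. Here [x ^ u = x * [x, u]] and [y ^ u = y * [y, u]], and
    [x, u] commutes with [y ^ u]. *)
Lemma filtration_commgR m x y u :
  P m.+1 [~ x, y] -> P m.+2 [~ [~ x, u], y ^ u] -> P m.+2 [~ x, [~ y, u]].
Proof.
move=> Pc Pd; have [Q [f [f1 _]]] := quotient_ex (nP m.+2).
have cP g : commute (f [~ x, y]) (f g).
  by apply/commgP/eqP; rewrite -gmulfR; exact/f1/PR1.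
have com a b : P m.+2 [~ a, b] -> commute (f a) (f b).
  by move=> /f1 h; apply/commgP/eqP; rewrite -gmulfR.
have yu : y ^ u = y * [~ y, u] by rewrite commgEl mulVKg.
have xu : x ^ u = x * [~ x, u] by rewrite commgEl mulVKg.
have e1 : f (x * [~ x, u]) * f (y * [~ y, u]) =
          f (y * [~ y, u]) * f (x * [~ x, u]) * f [~ x, y].
  rewrite -xu -yu -!gmulfM -!conjMg commgC conjMg [f (_ ^ u * _)]gmulfM [in RHS]gmulfM.
  by congr (_ * _); rewrite gmulfJ conjgE cP mulKg.
have e2 : f x * f y = f y * f x * f [~ x, y] by rewrite -!gmulfM -commgC.
have fyE : f (y * [~ y, u]) = f y * f [~ y, u] by exact: gmulfM.
have := com _ _ Pd; rewrite yu => cD.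
apply/f1; rewrite gmulfR; apply/eqP/commgP.
apply: (@commute_of_commg _ (f x) (f y) (f [~ x, u]) _ (f [~ x, y])) => //.
  by rewrite -fyE.
have fxD : f (x * [~ x, u]) = f x * f [~ x, u] by exact: gmulfM.
by rewrite -fyE -fxD.
Qed.

End CentralFiltration.

Section Cosets.
Variable T : groupType.
Implicit Types (H G N : set T) (x y : T).

Lemma coset_memE x H y : mulgs [set x] H y = H (x^-1 * y).
Proof.
apply/propext; split=> [[_ -> [h Hh <-]]|Hxy]; first by rewrite mulKg.
by exists x => //; exists (x^-1 * y) => //; rewrite mulVKg.
Qed.

Lemma coset_eqP x y H : is_subgroup H ->
  (mulgs [set x] H = mulgs [set y] H) <-> H (x^-1 * y).
Proof.
move=> sH; split=> [e|Hxy].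
  by rewrite -coset_memE e coset_memE mulVg; apply: subgroup1.
apply/seteqP; split=> z; rewrite !coset_memE => Hz.
  rewrite (_ : y^-1 * z = (x^-1 * y)^-1 * (x^-1 * z)); last first.
    by rewrite invgM invgK -mulgA mulVKg.
  by apply: subgroupM => //; apply: subgroupV.
rewrite (_ : x^-1 * z = (x^-1 * y) * (y^-1 * z)); last by rewrite -mulgA mulVKg.
exact: subgroupM.
Qed.

Lemma commg_sub_of_quotient_abelian N : is_normal_in N setT ->
  quotient_abelian setT N -> forall x y, N [~ x, y].
Proof.
move=> [sN _ nN] abN x y.
have cN z : cosets setT N (mulgs [set z] N) by exists z.
have e := abN _ _ (cN x) (cN y).
have : mulgs (mulgs [set y] N) (mulgs [set x] N) (x * y).
  rewrite -e; exists x; first by rewrite coset_memE mulVg; apply: subgroup1.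
  by exists y => //; rewrite coset_memE mulVg; apply: subgroup1.
move=> [a]; rewrite coset_memE => Na [b]; rewrite coset_memE => Nb ab.
rewrite (_ : [~ x, y] = (y^-1 * a) ^ x * (x^-1 * b)).
  by apply: subgroupM => //; apply: nN.
by rewrite commgEl !conjgE -ab !mulgA mulgK.
Qed.

End Cosets.

Lemma fibre_coset (T Q : groupType) (N : set T) (f : UMagmaMorphism.type T Q) x :
  (forall y, f y = 1 <-> N y) -> f @^-1` [set f x] = mulgs [set x] N.
Proof.
move=> f1; apply/seteqP; split=> y; rewrite coset_memE.
  by move=> /= e; apply/f1; rewrite gmulfM gmulfV e mulVg.
by move=> /f1 e /=; rewrite -(mulVKg x y) gmulfM e mulg1.
Qed.

(** If two distinct points had the same image, [A] without one of them would still surject onto [B],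
    which is as large as [A]. *)
Lemma finite_surj_inj (X Y : choiceType) (A : set X) (B : set Y) (f : X -> Y) :
  finite_set A -> A #= B -> (forall b, B b -> exists2 a, A a & f a = b) ->
  forall a a', A a -> A a' -> f a = f a' -> a = a'.
Proof.
move=> finA AB surj a a' Aa Aa' faa'; apply: contrapT => naa'.
have : B #<= A `\ a'.
  apply: card_le_trans (card_image_le f _); apply: subset_card_le => b /surj[c Ac <-].
  have [->|nca'] := pselect (c = a'); last by exists c.
  by exists a => //; split=> // aa'; apply: naa'.
have /finite_setP[n An] := finA.
rewrite -(card_le_eql AB) (card_le_eql An).
have finA' : finite_set (A `\ a') by exact: finite_setD.
move=> /(leq_card_fset_set finA'); rewrite leqNgt => /negP; apply.
rewrite -(card_fset_set An); apply: fproper_ltn_card.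
rewrite fproperE; apply/andP; split.
  by apply/fsubsetP => x; rewrite !in_fset_set // !inE => -[].
apply/fsubsetPn; rewrite /=; exists a'; rewrite in_fset_set // ?inE //.
by apply/negP => /set_mem [_ /(_ erefl)].
Qed.

(** * Closed subgroups of topological groups *)

Section TopologicalGroups.
Variable U : topologicalGroupType.
Implicit Types (H K S A : set U).

Lemma continuous_mulg (T : topologicalType) (f g : T -> U) :
  continuous f -> continuous g -> continuous (fun x => f x * g x).
Proof.
move=> cf cg x; apply: (@continuous2_cvg _ _ _ _ _ _ f g (fun a b : U => a * b)).
- exact: (@mulg_continuous U (f x, g x)).
- exact: cf.
- exact: cg.
Qed.

Lemma continuous_invg (T : topologicalType) (f : T -> U) :
  continuous f -> continuous (fun x => (f x)^-1).
Proof.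
by move=> cf x; apply: (continuous_comp (cf x)); apply: invg_continuous.
Qed.

Lemma continuous_cst (T : topologicalType) (a : U) : continuous (fun _ : T => a).
Proof. by move=> x; apply: cvg_cst. Qed.

Lemma continuous_idg : continuous (fun x : U => x).
Proof. by move=> x; apply: cvg_id. Qed.

Lemma closed_preimage (f : U -> U) A : continuous f -> closed A -> closed (f @^-1` A).
Proof. by move=> /continuous_closedP; apply. Qed.

Lemma closure_min A H : closed H -> A `<=` H -> closure A `<=` H.
Proof. by move=> cH AH; rewrite closureE; apply: smallest_sub. Qed.

Lemma closed_lcoset x H : closed H -> closed (mulgs [set x] H).
Proof.
rewrite (_ : mulgs _ _ = [set y | H (x^-1 * y)]); last first.
  by apply/seteqP; split=> y; rewrite coset_memE.
apply: (@closed_preimage (fun y => x^-1 * y)).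
by apply: continuous_mulg; [exact: continuous_cst|exact: continuous_idg].
Qed.

Lemma closure_subgroup H : is_subgroup H -> is_subgroup (closure H).
Proof.
move=> sH; have [H1 HB] := (is_subgroupP H).1 sH.
have HC x y : H y -> closure H x -> closure H (x / y).
  move=> Hy; move: x; apply: closure_min.
    apply: (@closed_preimage (fun x => x / y)); last exact: closed_closure.
    by apply: continuous_mulg; [exact: continuous_idg|exact: continuous_cst].
  by move=> x Hx; apply: subset_closure; apply: HB.
apply/is_subgroupP; split; first exact: subset_closure.
move=> x y Cx; move: y; apply: closure_min; last by move=> y Hy; apply: HC.
apply: (@closed_preimage (fun y => x / y)); last exact: closed_closure.
apply: continuous_mulg; first exact: continuous_cst.
exact: (continuous_invg continuous_idg).
Qed.

Lemma continuous_conjg g : continuous (fun x : U => x ^ g).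
Proof.
apply: continuous_mulg; first exact: continuous_cst.
by apply: continuous_mulg; [exact: continuous_idg|exact: continuous_cst].
Qed.

Lemma continuous_commg x : continuous (fun y : U => [~ x, y]).
Proof.
apply: continuous_mulg; first exact: continuous_cst.
apply: continuous_mulg; first exact: (continuous_invg continuous_idg).
by apply: continuous_mulg; [exact: continuous_cst|exact: continuous_idg].
Qed.

Lemma closure_normal H : is_normal_in H setT -> is_normal_in (closure H) setT.
Proof.
move=> [sH _ nH]; split=> //; first exact: closure_subgroup.
move=> x g Cx _; move: x Cx; apply: closure_min.
  by apply: closed_preimage; [exact: continuous_conjg|exact: closed_closure].
by move=> x Hx; apply: subset_closure; apply: nH.
Qed.

(** [S] is a finite union of cosets of the closed subgroup [H]. *)
Lemma finite_index_closed H S K : is_subgroup H -> is_subgroup S -> closed H ->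
  H `<=` S -> S `<=` K -> finite_set (cosets K H) -> closed S.
Proof.
move=> sH sS cH HS SK finK.
rewrite (_ : S = \bigcup_(A in [set A | cosets K H A /\ A `<=` S]) A).
  apply: closed_bigcup => [|_ [[x Kx <-] _]].
    by apply: sub_finite_set finK => A [].
  exact: closed_lcoset.
apply/seteqP; split=> [x Sx|x [A [_ AS] Ax]]; last exact: AS.
exists (mulgs [set x] H); last by rewrite coset_memE mulVg; apply: subgroup1.
split; first by exists x => //; apply: SK.
move=> y; rewrite coset_memE => /HS Sxy.
by rewrite -(mulVKg x y); apply: subgroupM.
Qed.

End TopologicalGroups.

(** * Descending series in finite p-groups *)

Module FinitePGroups.
Import fintype fingroup morphism quotient cyclic pgroup center nilpotent sylow.
Import GroupScope.
Local Close Scope classical_set_scope.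

Section FiniteCopy.
Variables (Q : groupType) (n : nat) (f : Q -> 'I_n) (g : 'I_n -> Q).
Hypothesis fK : cancel f g.
(** The type remembers the enumeration [fK], from which its finiteness instance is built. *)
Definition finite_copy : Type := let _ := fK in Q.
HB.instance Definition _ := Group.copy finite_copy Q.
HB.instance Definition _ : isCountable finite_copy := CanIsCountable fK.
HB.instance Definition _ : isFinite finite_copy :=
  CanIsFinite (fK : @cancel _ finite_copy f g).
End FiniteCopy.

(** Take S normal in G of index p in K. Then K / S has order p, meets the centre of the nilpotent
    group G / S, and so lies in it. *)
Lemma pgroup_normal_maximal (gT : finGroupType) (p r : nat) (G K : {group gT}) :
  prime p -> p.-group G -> K <| G -> #|K| = (p ^ r.+1)%N ->
  exists S : {group gT}, [/\ S <| G, #|S| = (p ^ r)%N,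
    forall x, x \in K -> x ^+ p \in S &
    forall x u, x \in K -> u \in G -> [~ x, u] \in S].
Proof.
move=> p_pr pG nKG oK.
have [S [sSK nSG oS]] : exists S : {group gT},
    [/\ S \subset K, S <| G & #|S| = (p ^ r)%N].
  by apply: normal_pgroup => //; rewrite oK pfactorK.
have nSK : S <| K by apply: normalS nSG => //; apply: normal_sub.
have oKS : #|K / S| = p.
  rewrite card_quotient ?normal_norm // -divgS // oK oS expnS mulnK //.
  by rewrite expn_gt0 prime_gt0.
have cent : K / S \subset 'Z(G / S).
  have p_prKS : prime #|K / S| by rewrite oKS.
  have := @meet_center_nil _ (G / S)%G (K / S)%G.
  rewrite (pgroup_nil (quotient_pgroup _ pG)) quotient_normal //.
  rewrite -cardG_gt1 oKS prime_gt1 // => /(_ isT isT isT) nt.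
  by apply: contraR nt => ns; rewrite prime_TIg.
exists S; split=> // [x Kx|x u Kx Gu].
  have nSx : x \in 'N(S) by apply: subsetP (normal_norm nSK) _ Kx.
  apply: coset_idr; first exact: groupX.
  by rewrite morphX // -oKS expg_cardG // mem_quotient.
have nSx : x \in 'N(S) by apply: subsetP (normal_norm nSK) _ Kx.
have nSu : u \in 'N(S) by apply: subsetP (normal_norm nSG) _ Gu.
apply: coset_idr; first exact: groupR.
rewrite morphR //; apply/eqP/commgP.
have /centerP[_ /(_ (coset S u))] : coset S x \in 'Z(G / S).
  by apply: (subsetP cent); rewrite mem_quotient.
by apply; rewrite mem_quotient.
Qed.

(** [D] will be the image of the lower p-series in a finite quotient. If a term lies in a normal
    subgroup K, the next one lies in a subgroup of index p of K, so the series reaches 1. *)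
Lemma pgroup_lower_series (gT : finGroupType) (p : nat) (D : nat -> gT -> Prop) :
  prime p -> p.-group [set: gT] ->
  (forall i (S : {group gT}), (forall x, D i x -> x ^+ p \in S) ->
     (forall x u, D i x -> [~ x, u] \in S) -> forall x, D i.+1 x -> x \in S) ->
  exists i, forall x, D i x -> x = 1.
Proof.
move=> p_pr pG DS.
suff H r : forall K : {group gT}, K <| [set: gT] -> #|K| = (p ^ r)%N ->
    (exists i, forall x, D i x -> x \in K) -> exists i, forall x, D i x -> x = 1.
  have [r oG] := p_natP pG.
  by apply: (H r [set: gT]%G) => //; exists 0%N => x; rewrite inE.
elim: r => [|r IHr] K nK oK [i DK].
  exists i => x /DK; have /eqP := oK; rewrite expn0 -trivg_card1 => /eqP ->.
  by rewrite inE => /eqP.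
have [S [nS oS SX SR]] := pgroup_normal_maximal p_pr pG nK oK.
apply: (IHr S) => //; exists i.+1; apply: DS => [x /DK|x u /DK Kx]; first exact: SX.
by apply: SR; rewrite ?inE.
Qed.

Lemma finite_pgroup_lower_series (Q : groupType) (p k : nat)
    (f : Q -> 'I_(p ^ k)) (g : 'I_(p ^ k) -> Q) (D : nat -> Q -> Prop) :
  prime p -> cancel f g -> cancel g f ->
  (forall i (S : Q -> Prop), is_subgroup S -> (forall x, D i x -> S (x ^+ p)) ->
     (forall x u, D i x -> S [~ x, u]) -> forall x, D i.+1 x -> S x) ->
  exists i, forall x, D i x -> x = 1.
Proof.
move=> p_pr fK gK DS.
have cardQ : #|{: finite_copy fK}| = (p ^ k)%N.
  rewrite -[RHS]card_ord; apply: (@bij_eq_card _ _ (f : finite_copy fK -> _)).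
  by exists g.
apply: (@pgroup_lower_series (finite_copy fK) p D p_pr).
  by rewrite /pgroup cardsT cardQ pnatX pnat_id.
move=> i S SX SR x Dx; apply: (DS i (fun x : finite_copy fK => x \in S)) => //.
apply/is_subgroupP; split=> [|a b aS bS]; first exact: group1.
by rewrite groupM ?groupV.
Qed.

End FinitePGroups.
Import FinitePGroups.

(** * The lower p-series of a uniform pro-p group *)

(** The interface between the topological part and the logarithm, whose construction uses these
    facts alone. The shift [p == 2] reflects that powerful means abelian modulo fourth powers when p
    = 2. *)
Record uniform_filtration (p : nat) (T : groupType) (P : nat -> set T) : Prop := {
  filtration_normal : forall n, is_normal_in (P n) setT;
  filtration0 : P 0 = setT;
  filtration_decr : forall n, P n.+1 `<=` P n;
  filtration_exp : forall n x, P n x -> P n.+1 (x ^+ p);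
  filtration_commg : forall i j x y, P i x -> P j y ->
    P (i + j + 1 + (p == 2))%N [~ x, y];
  filtration_exp_inj : forall n x, P n x -> P n.+2 (x ^+ p) -> P n.+1 x;
  filtration_exp_surj : forall n x, P n.+1 x ->
    exists2 y, P n y & P n.+2 ((y ^+ p)^-1 * x);
  filtration_sep : forall x, (forall n, P n x) -> x = 1;
  filtration_fin : finite_set (cosets setT (P 1%N))
}.

Lemma commgMl (Q : groupType) (a b u : Q) : [~ a * b, u] = [~ a, u] ^ b * [~ b, u].
Proof. by rewrite !commgEl conjMg [in RHS]conjMg conjVg !conjgE !gnorm. Qed.

(** * Open subgroups of compact groups *)

Section OpenSubgroups.
Variable U : topologicalGroupType.

(* [compact_cover] is only available over pointed spaces. *)
Definition pointed_copy : Type := U.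
HB.instance Definition _ := Topological.on pointed_copy.
HB.instance Definition _ := isPointed.Build pointed_copy (1 : U).

Lemma open_subgroup_cover (H : set U) : compact [set: U] -> is_subgroup H -> open H ->
  exists D : {fset U}, forall x, exists2 g, g \in D & H (g^-1 * x).
Proof.
move=> compU sH oH.
have covU : @cover_compact pointed_copy [set: U] by rewrite -compact_cover.
have [|x _|D _ DT] := covU U setT (fun g => [set x | H (g^-1 * x)]).
- move=> g _; apply: (open_comp (f := fun x : U => g^-1 * x)) oH => x _.
  by apply: continuous_mulg; [exact: continuous_cst|exact: continuous_idg].
- by exists x => //=; rewrite mulVg; exact: subgroup1.
- by exists D => x; have [g gD Hgx] := DT x I; exists g.
Qed.

Lemma open_normal_core (H : set U) : compact [set: U] -> is_subgroup H -> open H ->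
  exists N, [/\ is_normal_in N setT, open N & N `<=` H].
Proof.
move=> compU sH oH; have [D covD] := open_subgroup_cover compU sH oH.
pose N := [set x | forall g, H (x ^ g)].
exists N; split; last by move=> x /(_ 1); rewrite conjg1.
  split=> //; last by move=> x g Nx _ h; rewrite -conjgM.
  apply/is_subgroupP; split=> [g|x y Nx Ny g]; first by rewrite conj1g; exact: subgroup1.
  by rewrite conjMg conjVg; apply: subgroupM => //; exact: subgroupV.
(* Whether [x ^ g] lies in [H] depends only on the coset of [g] modulo [H], so finitely many
   conditions define [N]. *)
rewrite (_ : N = ~` \bigcup_(g in [set` D]) ~` [set x | H (x ^ g)]).
  apply: closed_openC; apply: closed_bigcup => // g _; apply: open_closedC.
  by apply: (open_comp (f := fun x : U => x ^ g)) oH => x _; exact: continuous_conjg.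
apply/seteqP; split=> [x Nx [g _ /(_ (Nx g))] //|x nx g].
have [h hD Hhg] := covD g; rewrite -(mulVKg h g) conjgM.
apply: subgroupJ => //; apply: contrapT => nHx; apply: nx; by exists h.
Qed.

End OpenSubgroups.

Section LowerPSeries.
Variables (p : nat) (U : topologicalGroupType).
Hypothesis p_pr : prime p.
Hypothesis unifU : is_uniform_pro_p p U.

Local Notation P := (lower_p_series p U).

Lemma lower_p_series_normal n : is_normal_in (P n) setT.
Proof.
elim: n => [|n IHn] /=; first by split=> //; exact: subgroupT.
apply: closure_normal; apply: mulgs_normal; first exact: powers_normal.
by apply: commgs_normal => //; split=> //; exact: subgroupT.
Qed.

Let sP n : is_subgroup (P n). Proof. by case: (lower_p_series_normal n). Qed.

Lemma lower_p_series_closed n : closed (P n).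
Proof. by case: n => [|n] /=; [exact: closedT|exact: closed_closure]. Qed.

Lemma lower_p_series_exp n x : P n x -> P n.+1 (x ^+ p).
Proof.
move=> Px; apply: subset_closure; exists (x ^+ p).
  by apply: sub_generated; exists x.
by exists 1; [apply: subgroup1; exact: generated_subgroup|rewrite mulg1].
Qed.

Lemma lower_p_series_commg1 n x u : P n x -> P n.+1 [~ x, u].
Proof.
move=> Px; apply: subset_closure; exists 1; first by apply: subgroup1; exact: generated_subgroup.
by exists [~ x, u]; [apply: commgs_mem|rewrite mul1g].
Qed.

(** This minimality replaces the definition: a property is proved on [P n.+1] by showing that it
    cuts out a closed subgroup containing the p-th powers and commutators of [P n]. *)
Lemma lower_p_series_min n S : is_subgroup S -> closed S ->
    (forall x, P n x -> S (x ^+ p)) -> (forall x u, P n x -> S [~ x, u]) ->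
  P n.+1 `<=` S.
Proof.
move=> sS cS SX SR; apply: closure_min => // _ [a Pa [b Pb <-]]; apply: subgroupM => //.
  by move: a Pa; apply: generated_min => // _ [x Px <-]; apply: SX.
by move: b Pb; apply: commgs_sub => // x u Px _; apply: SR.
Qed.

Lemma lower_p_series_decr n : P n.+1 `<=` P n.
Proof.
apply: lower_p_series_min => //; first exact: lower_p_series_closed.
  by move=> x Px; apply: subgroupX.
move=> x u Px; rewrite commgEl; apply: subgroupM => //; first exact: subgroupV.
by case: (lower_p_series_normal n) => _ _; apply.
Qed.

Lemma finite_subgroup_adjoin (Q : groupType) (Z : set Q) a :
    (forall x y : Q, commute x y) -> a ^+ p = 1 -> is_subgroup Z -> finite_set Z ->
  exists Z', [/\ is_subgroup Z', finite_set Z', Z `<=` Z' & Z' a].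
Proof.
move=> com ap sZ fZ; have p0 := prime_gt0 p_pr.
have expa i : a ^+ i = a ^+ (i %% p).
  by rewrite {1}(divn_eq i p) expgnDr mulnC expgnA ap expg1n mul1g.
exists [set a ^+ i * z | i in `I_p & z in Z]; split.
- apply/is_subgroupP; split.
    by exists 0%N => //; exists 1; [exact: subgroup1|rewrite mulg1].
  move=> _ _ [i ip [z Zz <-]] [j jp [w Zw <-]].
  exists ((i + (p - j)) %% p)%N; first by rewrite /= ltn_mod.
  exists (z / w); first by apply: subgroupM => //; exact: subgroupV.
  rewrite -expa expgnDr invgM -!mulgA; congr (_ * _).
  have -> : a ^+ (p - j) = (a ^+ j)^-1.
    by rewrite expgnFr ?ap ?mul1g // ltnW.
  by rewrite (com (a ^- j)) -mulgA.
- by apply: finite_image2 => //; exact: finite_II.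
- by move=> z Zz; exists 0%N => //; exists z => //; rewrite mul1g.
- exists (1 %% p)%N; first by rewrite /= ltn_mod.
  by exists 1; [exact: subgroup1|rewrite -expa mulg1].
Qed.

(** U / P 1 is abelian of exponent p, so the images of finitely many topological generators lie in a
    finite subgroup [Z]. Its preimage is a finite union of closed cosets, hence closed, and it is
    dense. *)
Lemma finite_quotient1 : finite_set (cosets setT (P 1)).
Proof.
have [Q [f [f1 fsurj]]] := quotient_ex (lower_p_series_normal 1).
have com (x y : Q) : commute x y.
  have [[a ->] [b ->]] := (fsurj x, fsurj y).
  apply/commgP/eqP; rewrite -gmulfR; apply/f1.
  exact: (@lower_p_series_commg1 0).
have expp (x : Q) : x ^+ p = 1.
  have [a ->] := fsurj x; rewrite -gmulfXn; apply/f1.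
  exact: (@lower_p_series_exp 0).
have [_ [A /finite_fsetP[F ->] clA] _ _] := unifU.
have adjoin (s : seq U) : exists Z : set Q,
    [/\ is_subgroup Z, finite_set Z & forall a, a \in s -> Z (f a)].
  elim: s => [|a s [Z [sZ fZ sZF]]].
    exists [set 1]; split=> //.
    by apply/is_subgroupP; split=> // x y -> ->; rewrite divgg.
  have [Z' [sZ' fZ' ZZ' Z'a]] := finite_subgroup_adjoin com (expp (f a)) sZ fZ.
  exists Z'; split=> // b; rewrite inE => /predU1P[->//|bs].
  by apply: ZZ'; apply: sZF.
have [Z [sZ fZ FZ]] := adjoin F.
have fibre x := fibre_coset x f1.
have ZT : f @^-1` Z = setT.
  apply/seteqP; split=> // x _.
  have : closure (generated [set` F]) x by rewrite clA.
  move: x; apply: closure_min.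
    rewrite (_ : f @^-1` Z = \bigcup_(z in Z) f @^-1` [set z]).
      apply: closed_bigcup => // z _; have [x ->] := fsurj z.
      by rewrite fibre; apply: closed_lcoset; exact: lower_p_series_closed.
    by apply/seteqP; split=> [y Zy|y [z Zz /= ->]]; [exists (f y)|].
  apply: generated_min; first exact: preimage_subgroup.
  by move=> a /= aF; apply: FZ.
apply: (@sub_finite_set _ _ ((fun z => f @^-1` [set z]) @` Z)); last exact: finite_image.
move=> _ [x _ <-]; exists (f x); last exact: fibre.
by have : (f @^-1` Z) x by rewrite ZT.
Qed.

Lemma finite_quotient n : finite_set (cosets (P n) (P n.+1)).
Proof.
have [_ _ _ /(_ n) e] := unifU.
by move: finite_quotient1 => /finite_setP[m Pm]; apply/finite_setP; exists m; rewrite (card_eql e).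
Qed.

Let e := nat_of_bool (p == 2).

Arguments lower_p_series : simpl never.

Lemma lower_p_series_powerful x u :
  closure (powers [set: U] (if p == 2 then 4 else p)) [~ x, u].
Proof.
have [_ _ powU _] := unifU; move: x u.
apply: commg_sub_of_quotient_abelian => //; apply: closure_normal.
by apply: powers_normal; split=> //; exact: subgroupT.
Qed.

(** The elements that are p-th powers from [P i] up to [P i.+2]; the aim is that they include all of
    [P i.+1]. *)
Definition exp_image i := [set x | exists2 y, P i y & P i.+2 ((y ^+ p)^-1 * x)].

Lemma lower_p_series_expgM i :
  (forall x u, P i x -> P (i + 1 + e)%N [~ x, u]) ->
  forall b z, P i z -> P i.+2 (((b * z) ^+ p)^-1 * (b ^+ p * z ^+ p)).
Proof.
move=> R b z Pz; apply: filtration_expgM => //.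
- exact: lower_p_series_normal.
- exact: lower_p_series_exp.
- exact: lower_p_series_commg1.
- exact: lower_p_series_commg1.
- by move=> p2; have := R z b Pz; rewrite /e p2 eqxx !addn1.
Qed.

Lemma exp_image_subgroup i :
  (forall x u, P i x -> P (i + 1 + e)%N [~ x, u]) -> is_subgroup (exp_image i).
Proof.
move=> R; have [Q [f [f1 _]]] := quotient_ex (lower_p_series_normal i.+2).
have fS x : exp_image i x <-> exists2 y, P i y & f x = f y ^+ p.
  split=> -[y Py h]; exists y => //.
    by move/f1: h; rewrite gmulfM gmulfV gmulfXn => /(canRL (mulVKg _)); rewrite mulg1.
  by apply/f1; rewrite gmulfM gmulfV gmulfXn h mulVg.
have Hf b z : P i z -> f (b * z) ^+ p = f b ^+ p * f z ^+ p.
  move=> Pz; have /f1 := @lower_p_series_expgM i R b z Pz.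
  rewrite gmulfM gmulfV [f (_ * z ^+ p)]gmulfM !gmulfXn.
  by move=> /(canRL (mulVKg _)); rewrite mulg1 => ->.
apply/is_subgroupP; split.
  by apply/fS; exists 1; [exact: subgroup1|rewrite !gmulf1 expg1n].
move=> x w /fS[a Pa fx] /fS[b Pb fw]; apply/fS; exists (a / b).
  by apply: subgroupM => //; exact: subgroupV.
by rewrite gmulfF fx fw Hf ?gmulfV ?expVgn //; exact: subgroupV.
Qed.

Lemma exp_image_exp i x : P i x -> exp_image i (x ^+ p).
Proof. by move=> Px; exists x => //; rewrite mulVg; exact: subgroup1. Qed.

Lemma exp_image_closed i :
  (forall x u, P i x -> P (i + 1 + e)%N [~ x, u]) -> closed (exp_image i).
Proof.
move=> R; apply: (@finite_index_closed _ (P i.+2) _ (P i.+1)) => //.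
- exact: exp_image_subgroup.
- exact: lower_p_series_closed.
- by move=> x Px; exists 1; [exact: subgroup1|rewrite expg1n invg1 mul1g].
- move=> x [y Py /lower_p_series_decr Pyx].
  by rewrite -(mulVKg (y ^+ p) x); apply: (subgroupM (sP _)) Pyx; exact: lower_p_series_exp.
- exact: finite_quotient.
Qed.

(* On a quotient by [P i.+2], conjugating [y ^+ p] by [u] and comparing with
   [(y * [~ y, u]) ^+ p = y ^+ p * [~ y, u] ^+ p] turns commutators of p-th
   powers into p-th powers of commutators. *)
Lemma lower_p_series_commgXp i x y u :
  (forall x u, P i x -> P (i + 1 + e)%N [~ x, u]) ->
  P i [~ y, u] -> P i.+1 ((y ^+ p)^-1 * x) ->
  P i.+2 (([~ y, u] ^+ p)^-1 * [~ x, u]).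
Proof.
move=> R Pc Pyx; have [Q [f [f1 _]]] := quotient_ex (lower_p_series_normal i.+2).
set z := _ * x in Pyx.
have cz : commute (f z) (f u).
  by apply/commgP/eqP; rewrite -gmulfR; apply/f1; exact: lower_p_series_commg1.
have xE : x = y ^+ p * z by rewrite mulVKg.
have /f1 := @lower_p_series_expgM i R y _ Pc.
rewrite [y * _](_ : _ = y ^ u); last by rewrite commgEl mulVKg.
rewrite gmulfM gmulfV => /(canRL (mulVKg _)); rewrite mulg1 gmulfM => h.
have fx : f x = f (y ^+ p) * f z by rewrite -gmulfM -xE.
apply/f1; rewrite gmulfM gmulfV [f [~ x, u]]gmulfR fx [[~ _ * _, _]]commgEl conjMg.
have -> : f z ^ f u = f z by apply/conjg_fixP; rewrite commgEl conjgE cz mulKg mulVg.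
have -> : f (y ^+ p) ^ f u = f (y ^+ p) * f ([~ y, u] ^+ p).
  by rewrite h -gmulfJ conjXg.
have cc : commute (f ([~ y, u] ^+ p)) (f z).
  apply/commgP/eqP; rewrite -gmulfR; apply/f1.
  by apply: lower_p_series_commg1; exact: lower_p_series_exp.
by rewrite invgM -!mulgA mulKg cc mulKg mulVg.
Qed.

(** The two claims support each other. The first makes [exp_image i] a closed subgroup. The second
    writes an element of [P i.+1] as [y ^+ p * z] with [y] in [P i] and [z] in [P i.+2], which
    reduces its commutators with [u] to [[y, u] ^+ p]. Powerfulness starts the induction. *)
Lemma lower_p_series_step i :
  (forall x u, P i x -> P (i + 1 + e)%N [~ x, u]) /\ P i.+1 `<=` exp_image i.
Proof.
elim: i => [|i [R S]].
  have R x u : P 0 x -> P (0 + 1 + e)%N [~ x, u].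
    have [p2|p_neq2] := eqVneq p 2; last first.
      by rewrite /e (negPf p_neq2); exact: (@lower_p_series_commg1 0).
    rewrite (_ : (0 + 1 + e)%N = 2); last by rewrite /e p2.
    move=> _; move: (@lower_p_series_powerful x u); rewrite {1}p2 /=.
    move: [~ x, u]; apply: (@closure_min _ _ (P 2)); first exact: lower_p_series_closed.
    apply: (@generated_min _ _ (P 2)) => // _ [y _ <-].
    have -> : y ^+ 4 = (y ^+ p) ^+ p by rewrite -expgnA p2.
    by apply: (@lower_p_series_exp 1); exact: (@lower_p_series_exp 0).
  split=> //; apply: lower_p_series_min.
  - exact: exp_image_subgroup.
  - exact: exp_image_closed.
  - exact: exp_image_exp.
  move=> x u _; move: (@lower_p_series_powerful x u); move: [~ x, u].
  apply: closure_min; first exact: exp_image_closed.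
  apply: generated_min; first exact: exp_image_subgroup.
  move=> _ [y _ <-]; case: eqP => [p2|_]; last exact: exp_image_exp.
  have -> : y ^+ 4 = (y ^+ p) ^+ p by rewrite -expgnA p2.
  exact: exp_image_exp.
have R' x u : P i.+1 x -> P (i.+1 + 1 + e)%N [~ x, u].
  have [p2|p_neq2] := eqVneq p 2; last first.
    by rewrite /e (negPf p_neq2) addn0 addn1; exact: lower_p_series_commg1.
  have e1 : e = 1%N by rewrite /e p2.
  rewrite e1 !addn1 => Px.
  have [y Py Pyx] := S _ Px.
  have Pc : P i.+2 [~ y, u] by have := R y u Py; rewrite e1 !addn1.
  have Pyu : P i.+3 [~ y ^+ p, u].
    rewrite commgEl conjXg; apply: (@filtration_congX p U P) => //.
    - exact: lower_p_series_normal.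
    - exact: lower_p_series_exp.
    - exact: lower_p_series_commg1.
  rewrite -(mulVKg (y ^+ p) x); set z := _ * x in Pyx *; rewrite commgMl.
  have [_ _ nP3] := lower_p_series_normal i.+3.
  by apply: (subgroupM (sP _)); [exact: nP3|exact: lower_p_series_commg1].
split=> //; apply: lower_p_series_min.
- exact: exp_image_subgroup.
- exact: exp_image_closed.
- exact: exp_image_exp.
move=> x u Px; have [y Py Pyx] := S _ Px.
have Pc := @lower_p_series_commg1 _ _ u Py.
exists [~ y, u] => //; apply: (@lower_p_series_commgXp i.+1) => //.
Qed.

(** For fixed [x], the [y] with [x, y] deep enough form a closed subgroup, so only p-th powers and
    commutators in the second argument have to be treated. *)
Lemma lower_p_series_commg j i x y : P i x -> P j y -> P (i + j + 1 + e)%N [~ x, y].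
Proof.
elim: j i x y => [|j IHj] i x y Px.
  by rewrite addn0 => _; case: (lower_p_series_step i) => R _; exact: R.
rewrite (addnS i j) !addSn; set m := (i + j + 1 + e)%N.
have Z1 y' : P m.+1 [~ x, y'] <-> P m.+1 [~ y', x].
  by split=> /(subgroupV (sP _)); rewrite invgR.
have [_ _ nPm] := lower_p_series_normal m.+1.
suff h : P j.+1 `<=` [set y | P m.+1 [~ x, y]] by move=> /h.
clear y.
apply: lower_p_series_min.
- apply/is_subgroupP; split; first by rewrite /= commg1; exact: subgroup1.
  move=> a b /Z1 Pa /Z1 Pb; apply/Z1; rewrite commgMl.
  apply: (subgroupM (sP _)); first exact: nPm.
  rewrite (_ : [~ b^-1, x] = ([~ b, x] ^ b^-1)^-1).
    by apply: (subgroupV (sP _)); exact: nPm.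
  by rewrite -[in RHS]conjVg [in RHS]invgR !commgEl !conjgE !gnorm.
- apply: closed_preimage; last exact: lower_p_series_closed.
  exact: continuous_commg.
- move=> y Py /=; apply: (@filtration_commgX p U P) => //.
  + exact: lower_p_series_normal.
  + exact: lower_p_series_exp.
  + exact: lower_p_series_commg1.
  + exact: IHj.
- move=> y u Py /=.
  have mE : m = (i + j + e).+1 by rewrite /m addn1 addSn.
  rewrite mE; apply: (@filtration_commgR U P) => //.
  + exact: lower_p_series_normal.
  + exact: lower_p_series_commg1.
  + by rewrite -mE; exact: IHj.
  (* The induction hypothesis is used at [x, u], which lies in [P i.+1]; this is why [i] varies in
     the induction on [j]. *)
  rewrite -mE (_ : m.+1 = (i.+1 + j + 1 + e)%N); last by rewrite /m !addSn.
  apply: IHj; first exact: lower_p_series_commg1.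
  by have [_ _ nPj] := lower_p_series_normal j; exact: nPj.
Qed.

(** Uniformity enters here: the p-th power map between consecutive sections is a surjection of
    finite sets of the same size, hence injective. *)
Lemma lower_p_series_exp_inj n x : P n x -> P n.+2 (x ^+ p) -> P n.+1 x.
Proof.
move=> Px Pxp; have [_ _ _ cardP] := unifU.
(* The p-th power map on cosets, through a chosen representative; [phiE] shows that the choice does
   not matter. *)
pose phi (A : set U) := mulgs [set (xget 1 A) ^+ p] (P n.+2).
have congX a b : P n.+1 (a^-1 * b) -> P n.+2 ((a ^+ p)^-1 * b ^+ p).
  apply: (@filtration_congX p U P) => //.
  - exact: lower_p_series_normal.
  - exact: lower_p_series_exp.
  - exact: lower_p_series_commg1.
have phiE a : phi (mulgs [set a] (P n.+1)) = mulgs [set a ^+ p] (P n.+2).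
  apply/(coset_eqP _ _ (sP _)); rewrite -[X in P _ X]invgK invgM invgK.
  apply: (subgroupV (sP _)); apply: congX.
  rewrite -coset_memE; apply: xgetPex.
  by exists a; rewrite coset_memE mulVg; exact: subgroup1.
have /(coset_eqP _ _ (sP _)) : mulgs [set 1] (P n.+1) = mulgs [set x] (P n.+1).
  apply: (@finite_surj_inj _ _ (cosets (P n) (P n.+1)) (cosets (P n.+1) (P n.+2)) phi).
  - exact: finite_quotient.
  - by rewrite (card_eql (cardP n)) card_eq_sym; exact: cardP.
  - move=> _ [w Pw <-]; have [_ S] := lower_p_series_step n.
    have [y Py Pyw] := S _ Pw; exists (mulgs [set y] (P n.+1)); first by exists y.
    by rewrite phiE; apply/(coset_eqP _ _ (sP _)).
  - by exists 1 => //; exact: subgroup1.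
  - by exists x.
  - rewrite !phiE; apply/(coset_eqP _ _ (sP _)).
    by rewrite expg1n invg1 mul1g.
by rewrite invg1 mul1g.
Qed.

Lemma quotient_enum (N : set U) (Q : groupType) (f : UMagmaMorphism.type U Q) m :
  (forall x, f x = 1 <-> N x) -> (forall a, exists x, a = f x) ->
  cosets [set: U] N #= `I_m ->
  exists (h : Q -> 'I_m) (g : 'I_m -> Q), cancel h g /\ cancel g h.
Proof.
move=> f1 fsurj cardN.
have fibre x := fibre_coset x f1.
have inj : {in [set: Q] &, injective (fun a : Q => f @^-1` [set a])}.
  move=> a b _ _; have [x ->] := fsurj a => ab.
  by have : (f @^-1` [set b]) x by rewrite -ab.
have : [set: Q] #= [set: 'I_m].
  apply: card_eq_trans card_II; apply: card_eq_trans cardN.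
  rewrite card_eq_sym; apply: card_eq_trans (inj_card_eq inj).
  rewrite (_ : _ @` _ = cosets [set: U] N) //.
  apply/seteqP; split=> [_ [a _ <-]|_ [x _ <-]].
    by have [x ->] := fsurj a; exists x => //; rewrite fibre.
  by exists (f x) => //; rewrite fibre.
move=> /card_bijP[h [g hK gK]].
exists (fun a => val (h (SigSub (mem_setT a)))), (fun i => val (g (SigSub (mem_setT i)))).
split=> a.
  by rewrite [X in g X](_ : _ = h (SigSub (mem_setT a))) ?hK //; exact: val_inj.
by rewrite [X in h X](_ : _ = g (SigSub (mem_setT a))) ?gK //; exact: val_inj.
Qed.

(** If [x] is not 1, some open normal subgroup [N] misses it. The lower p-series dies in the finite
    p-group U / N, so some [P i] lies in [N]. *)
Lemma lower_p_series_sep x : (forall n, P n x) -> x = 1.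
Proof.
move=> Px; apply: contrapT => x1.
have [[[compU hausU baseU] pU] _ _ _] := unifU.
have clx : closed [set x].
  by apply: accessible_closed_set1; exact: hausdorff_accessible.
have [|H [sH oH HV]] := baseU (~` [set x]).
  by apply: open_nbhs_nbhs; split; [exact: closed_openC|move=> /esym].
have [N [nN oN NH]] := open_normal_core compU sH oH.
have [k cardN] := pU N nN oN.
have [Q [f [f1 fsurj]]] := quotient_ex nN.
have [h [g [hK gK]]] := quotient_enum f1 fsurj cardN.
have sN : is_subgroup N by case: nN.
have [i Pi] : exists i, forall a, (f @` P i) a -> a = 1.
  apply: (finite_pgroup_lower_series p_pr hK gK) => i S sS SX SR _ [y Py <-].
  suff PS : P i.+1 `<=` f @^-1` S by exact: PS.
  apply: lower_p_series_min.
  - exact: preimage_subgroup.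
  - rewrite (_ : _ @^-1` _ = ~` (\bigcup_(y in ~` (f @^-1` S)) [set z | N (y^-1 * z)])).
      apply: open_closedC; apply: bigcup_open => a _.
      apply: (open_comp (f := fun z : U => a^-1 * z)) oN => z _.
      by apply: continuous_mulg; [exact: continuous_cst|exact: continuous_idg].
    apply/seteqP; split=> [z Sz [a nSa /f1]|z nz].
      rewrite gmulfM gmulfV => /(canRL (mulVKg _)); rewrite mulg1 => e'.
      by apply: nSa; rewrite /= -e'.
    apply: contrapT => nSz; apply: nz; exists z => //=.
    by rewrite mulVg; exact: subgroup1.
  - by move=> a Pa /=; rewrite gmulfXn; apply: SX; exists a.
  - by move=> a u Pa /=; rewrite gmulfR; apply: SR; exists a.
apply: (HV x) => //; apply: NH; apply/f1; apply: Pi.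
by exists x.
Qed.

Lemma uniform_filtration_lower_p_series : uniform_filtration p P.
Proof.
split.
- exact: lower_p_series_normal.
- by [].
- exact: lower_p_series_decr.
- exact: lower_p_series_exp.
- by move=> i j x y; exact: lower_p_series_commg.
- exact: lower_p_series_exp_inj.
- by move=> n; case: (lower_p_series_step n).
- exact: lower_p_series_sep.
- exact: finite_quotient1.
Qed.

End LowerPSeries.

Local Close Scope group_scope.
Local Close Scope card_scope.
Local Close Scope classical_set_scope.

(** * The p-adic integers *)

Section PadicIntegers.
Import GRing.Theory.
Variables (p : nat) (p_pr : prime p).

(** Being a remainder, [a n] is reduced modulo [p ^ n]; hence equality of p-adic integers is
    pointwise. *)
Definition padic_compatible (a : nat -> nat) : bool :=
  `[< forall n, a n.+1 %% p ^ n = a n >].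

(* A p-adic integer is the sequence of its residues [a n] modulo [p ^ n]. *)
Record padic_seq : Type :=
  Padic { residue :> nat -> nat; residueP : padic_compatible residue }.

(* The ring structure needs [p] to be prime, hence the proof in the type. *)
Definition padic : Type := let _ := p_pr in padic_seq.

HB.instance Definition _ := [isSub for residue].
HB.instance Definition _ := [Choice of padic by <:].

Implicit Types a b : padic.

Lemma padicP a b : (forall n, a n = b n) -> a = b.
Proof. by move=> ab; apply: val_inj; apply: funext. Qed.

Lemma residue_modS a n : a n.+1 %% p ^ n = a n.
Proof. by have /asboolP := residueP a. Qed.

Lemma residue_mod a m n : m <= n -> a n %% p ^ m = a m.
Proof.
move=> /subnK <-; elim: (n - m) => [|k IHk].
  by rewrite add0n -[in LHS](residue_modS a m) modn_mod residue_modS.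
by rewrite -IHk addSn -(residue_modS a (k + m)) modn_dvdm // dvdn_exp2l // leq_addl.
Qed.

Lemma residue_modn a n : a n %% p ^ n = a n.
Proof. exact: residue_mod. Qed.

Fact mk_padic_subproof (c : nat -> nat) : (forall n, c n.+1 = c n %[mod p ^ n]) ->
  padic_compatible (fun n => c n %% p ^ n).
Proof. by move=> cP; apply/asboolP => n; rewrite modn_dvdm ?dvdn_exp2l. Qed.

Definition mk_padic c cP : padic := Padic (@mk_padic_subproof c cP).

Fact padic_zero_subproof n : 0 = 0 %[mod p ^ n]. Proof. by []. Qed.
Definition padic_zero := @mk_padic (fun _ => 0) padic_zero_subproof.

Fact padic_one_subproof n : 1 = 1 %[mod p ^ n]. Proof. by []. Qed.
Definition padic_one := @mk_padic (fun _ => 1) padic_one_subproof.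

Fact padic_add_subproof a b n : a n.+1 + b n.+1 = a n + b n %[mod p ^ n].
Proof. by rewrite -modnDm !residue_modS. Qed.
Definition padic_add a b := mk_padic (padic_add_subproof a b).

Fact padic_mul_subproof a b n : a n.+1 * b n.+1 = a n * b n %[mod p ^ n].
Proof. by rewrite -modnMm !residue_modS. Qed.
Definition padic_mul a b := mk_padic (padic_mul_subproof a b).

Let p_gt0 : 0 < p. Proof. exact: prime_gt0. Qed.
Let pX_gt0 n : 0 < p ^ n. Proof. by rewrite expn_gt0 p_gt0. Qed.

(** The opposite is the product with -1, whose residue is [p ^ n - 1]. *)
Fact padic_opp_subproof a n :
  a n.+1 * (p ^ n.+1).-1 = a n * (p ^ n).-1 %[mod p ^ n].
Proof.
have e : (p ^ n.+1).-1 = (p ^ n).-1 %[mod p ^ n].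
  by rewrite -!subn1 expnS -{1}(prednK p_gt0) mulSn addnC -addnBA // modnMDl.
by rewrite -modnMm residue_modS e modnMmr.
Qed.
Definition padic_opp a := mk_padic (padic_opp_subproof a).

Lemma padic_addA : associative padic_add.
Proof. by move=> a b c; apply: padicP => n /=; rewrite modnDml modnDmr addnA. Qed.
Lemma padic_addC : commutative padic_add.
Proof. by move=> a b; apply: padicP => n /=; rewrite addnC. Qed.
Lemma padic_add0 : left_id padic_zero padic_add.
Proof. by move=> a; apply: padicP => n /=; rewrite mod0n add0n residue_modn. Qed.
Lemma padic_addN : left_inverse padic_zero padic_opp padic_add.
Proof.
move=> a; apply: padicP => n /=; rewrite modnDml -[X in _ + X]muln1 -mulnDr addn1.
by rewrite prednK // modnMl mod0n.
Qed.

HB.instance Definition _ := GRing.isZmodule.Build padic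
  padic_addA padic_addC padic_add0 padic_addN.

Lemma padic_mulA : associative padic_mul.
Proof. by move=> a b c; apply: padicP => n /=; rewrite modnMml modnMmr mulnA. Qed.
Lemma padic_mulC : commutative padic_mul.
Proof. by move=> a b; apply: padicP => n /=; rewrite mulnC. Qed.
Lemma padic_mul1 : left_id padic_one padic_mul.
Proof. by move=> a; apply: padicP => n /=; rewrite modnMml mul1n residue_modn. Qed.
Lemma padic_mulD : left_distributive padic_mul padic_add.
Proof.
by move=> a b c; apply: padicP => n /=; rewrite modnMml modnDml modnDmr mulnDl.
Qed.
Lemma padic_oner_neq0 : padic_one != 0%R.
Proof.
apply/eqP => /(congr1 (fun a : padic => a 1)) /=.
by rewrite mod0n expn1 modn_small // prime_gt1.
Qed.

HB.instance Definition _ := GRing.Zmodule_isComNzRing.Build padic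
  padic_mulA padic_mulC padic_mul1 padic_mulD padic_oner_neq0.

Lemma residue0 n : (0%R : padic) n = 0. Proof. exact: mod0n. Qed.
Lemma residueD a b n : (a + b)%R n = (a n + b n) %% p ^ n. Proof. by []. Qed.
Lemma residueM a b n : (a * b)%R n = (a n * b n) %% p ^ n. Proof. by []. Qed.
Lemma residue_nat m n : (m%:R%R : padic) n = m %% p ^ n.
Proof.
elim: m => [|m IHm]; first by rewrite mulr0n residue0 mod0n.
by rewrite mulrS residueD IHm modnDml modnDmr.
Qed.

(** The residues of the quotient come from residues [n] places further: [a (n + m)] divided by
    [p ^ n]. *)
Lemma padic_divp a n : a n = 0 -> exists b, a = ((p ^ n)%:R * b)%R.
Proof.
move=> an0.
have div m : n <= m -> p ^ n %| a m by move=> nm; rewrite /dvdn residue_mod ?an0.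
have cP m : a (n + m.+1) %/ p ^ n = a (n + m) %/ p ^ n %[mod p ^ m].
  apply/eqP; rewrite -(eqn_pmul2l (pX_gt0 n)) !muln_modr -expnD.
  rewrite ![p ^ n * _]mulnC !divnK ?div ?leq_addr // addnS residue_modS residue_modn //.
exists (mk_padic cP); apply: padicP => m; rewrite residueM residue_nat modnMml /=.
rewrite muln_modr -expnD modn_dvdm ?dvdn_exp2l ?leq_addl //.
by rewrite mulnC divnK ?div ?leq_addr // residue_mod // leq_addl.
Qed.

Lemma padic_natM_eq0 n a : ((p ^ n)%:R * a = 0 -> a = 0)%R.
Proof.
move=> pa0; apply: padicP => m; have := congr1 (fun b : padic => b (n + m)) pa0.
rewrite residueM residue_nat modnMml !residue0 -(residue_mod a (leq_addl n m)).
rewrite expnD -muln_modr => /eqP.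
by rewrite muln_eq0 -leqn0 leqNgt pX_gt0 => /eqP.
Qed.

Lemma padic_norm a : a != 0%R -> exists n b, a = ((p ^ n)%:R * b)%R /\ b 1 != 0.
Proof.
move=> a0; have ex : exists n, a n != 0.
  apply: contrapT => all0; case/eqP: a0; apply: padicP => n; rewrite residue0.
  by apply/eqP/negP => /negP an; apply: all0; exists n.
have [[|n] an min] := ex_minnP ex; first by rewrite -residue_modn modn1 in an.
have an0 : a n = 0.
  by apply/eqP; apply: contraT => /min; rewrite ltnn.
have [b ab] := padic_divp an0; exists n, b; split=> //.
apply: contraNneq an => b0; rewrite ab residueM residue_nat modnMml.
have -> : p ^ n.+1 = p ^ n * p ^ 1 by rewrite -expnD addn1.
by rewrite -muln_modr residue_mod // b0 muln0.
Qed.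

Lemma padic_integral a b : (a * b = 0 -> (a == 0) || (b == 0))%R.
Proof.
move=> ab0; apply: contraT; rewrite negb_or => /andP[/padic_norm[m [u [au u1]]]].
case/padic_norm=> n [v [bv v1]]; move: ab0; rewrite au bv mulrACA -natrM -expnD.
move/padic_natM_eq0 => /(congr1 (fun b : padic => b 1)).
have mod1 (c : padic) : p %| c 1 = (c 1 == 0).
  by rewrite /dvdn -[X in _ %% X]expn1 residue_modn.
rewrite residueM residue0 expn1 => /eqP; rewrite -/(dvdn p (_ * _)) Euclid_dvdM //.
by rewrite !mod1 (negPf u1) (negPf v1).
Qed.

Definition padic_unit : pred padic := fun a => `[< exists b, (b * a = 1)%R >].
Definition padic_inv a : padic :=
  if pselect (exists b, (b * a = 1)%R) is left h then projT1 (cid h) else a.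

Fact padic_mulVr : {in padic_unit, left_inverse 1%R padic_inv *%R}.
Proof.
move=> a /asboolP h; rewrite /padic_inv; case: pselect => // h'.
exact: (projT2 (cid h')).
Qed.
Fact padic_unitPl a b : (b * a = 1)%R -> padic_unit a.
Proof. by move=> ba; apply/asboolP; exists b. Qed.
Fact padic_invr_out : {in [predC padic_unit], padic_inv =1 id}.
Proof.
by move=> a /negP h; rewrite /padic_inv; case: pselect => // h'; case: h; apply/asboolP.
Qed.
HB.instance Definition _ := GRing.ComNzRing_hasMulInverse.Build padic
  padic_mulVr padic_unitPl padic_invr_out.
HB.instance Definition _ := GRing.ComUnitRing_isIntegral.Build padic padic_integral.

Lemma padic_nat_neq0 n : 0 < n -> (n%:R != 0 :> padic)%R.
Proof.
move=> n0; apply/eqP => /(congr1 (fun b : padic => b n)).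
rewrite residue_nat residue0 modn_small; last exact/ltn_expl/prime_gt1.
by move=> e; rewrite e in n0.
Qed.

End PadicIntegers.

(** * The logarithm *)

Local Open Scope classical_set_scope.
Local Open Scope group_scope.

Section Logarithm.
Variables (p : nat) (T : groupType) (P : nat -> set T).
Hypothesis p_pr : prime p.
Hypothesis uP : uniform_filtration p P.

Let e : nat := (p == 2).
Let nP n : is_normal_in (P n) setT. Proof. exact: filtration_normal uP n. Qed.
Let sP n : is_subgroup (P n). Proof. by case: (nP n). Qed.
Let p_gt0 : 0 < p. Proof. exact: prime_gt0. Qed.
Let pX_gt0 n : 0 < p ^ n. Proof. by rewrite expn_gt0 p_gt0. Qed.
Let PX n x : P n x -> P n.+1 (x ^+ p). Proof. exact: (filtration_exp uP). Qed.

Lemma filtration_all x : P 0 x. Proof. by rewrite (filtration0 uP). Qed.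

Lemma filtration_le m n x : m <= n -> P n x -> P m x.
Proof.
move=> /subnK <-; elim: (n - m) => [//|k IHk] Px.
by apply: IHk; apply: (filtration_decr uP).
Qed.

Let PR1 n x u : P n x -> P n.+1 [~ x, u].
Proof.
move=> Px; have := filtration_commg uP Px (filtration_all u).
by apply: filtration_le; rewrite addn0 addn1 leq_addr.
Qed.

Variables (Q : nat -> groupType) (pi : forall n, UMagmaMorphism.type T (Q n)).
Hypothesis pi1 : forall n x, pi n x = 1 <-> P n x.

Lemma pi_eqP n x y : pi n x = pi n y <-> P n (x^-1 * y).
Proof.
rewrite -pi1 gmulfM gmulfV; split=> [->|]; first by rewrite mulVg.
by move=> /(canRL (mulVKg _)); rewrite mulg1.
Qed.

Lemma pi_le m n x y : m <= n -> pi n x = pi n y -> pi m x = pi m y.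
Proof. by move=> mn /pi_eqP h; apply/pi_eqP; apply: filtration_le h. Qed.

Lemma pi_commute i j k x y : P i x -> P j y -> k <= i + j + 1 + e ->
  commute (pi k x) (pi k y).
Proof.
move=> Px Py kij; apply/commgP/eqP; rewrite -gmulfR; apply/pi1.
by apply: filtration_le (filtration_commg uP Px Py).
Qed.

Lemma pi_exp n m x y : pi n x = pi n y -> pi (n + m) (x ^+ (p ^ m)) = pi (n + m) (y ^+ (p ^ m)).
Proof.
move=> xy; elim: m => [|m /pi_eqP IHm]; first by rewrite addn0 expn0 !expg1.
rewrite addnS expnSr !expgnA; apply/pi_eqP; exact: (@filtration_congX p _ P).
Qed.

(** By induction [y = x * z] with [z] in [P n]. Then [y ^+ p] and [x ^+ p * z ^+ p] agree modulo
    [P n.+2], so [z ^+ p] lies there and [z] lies in [P n.+1]. *)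
Lemma pi_expg_inj1 n x y : pi n.+1 (x ^+ p) = pi n.+1 (y ^+ p) -> pi n x = pi n y.
Proof.
elim: n => [|n IHn] xy; first by apply/pi_eqP; exact: filtration_all.
have /pi_eqP := IHn (pi_le (leqnSn _) xy); set z := _ * y => Pz.
have yE : y = x * z by rewrite mulVKg.
apply/pi_eqP; apply: (filtration_exp_inj uP) => //; apply/pi1.
have : pi n.+2 ((x * z) ^+ p) = pi n.+2 (x ^+ p * z ^+ p).
  apply/pi_eqP; apply: (@filtration_expgM p _ P) => // [|p2]; first exact: PR1.
  have := filtration_commg uP Pz (filtration_all x).
  by rewrite p2 eqxx addn0 !addn1.
by rewrite -yE -xy gmulfM -[LHS]mulg1 => /mulgI.
Qed.

Lemma pi_expg_inj n m x y :
  pi (n + m) (x ^+ (p ^ m)) = pi (n + m) (y ^+ (p ^ m)) -> pi n x = pi n y.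
Proof.
elim: m => [|m IHm]; first by rewrite addn0 expn0 !expg1.
by rewrite addnS expnSr !expgnA => /pi_expg_inj1.
Qed.

Lemma expg_in n m x : P n x -> P (n + m) (x ^+ (p ^ m)).
Proof.
move=> Px; elim: m => [|m IHm]; first by rewrite addn0 expn0 expg1.
by rewrite addnS expnSr expgnA; exact: PX.
Qed.

(** * Coordinates in the sections of the filtration *)

Section Monomials.
Variables (d : nat) (b : nat -> T).
Implicit Types (c : nat -> nat).

(* The element with coordinates [c] in the section [P n / P (2n)]. *)
Definition monomial n c := \prod_(i < d) b i ^+ (p ^ n * c i).

Lemma base_in n i k : P n (b i ^+ (p ^ n * k)).
Proof.
rewrite expgnA; apply: subgroupX => //; rewrite -{1}[n]add0n.
by apply: expg_in; exact: filtration_all.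
Qed.

Lemma monomial_in n c : P n (monomial n c).
Proof.
apply: big_ind => [|x y|i _]; [exact: subgroup1|exact: subgroupM|exact: base_in].
Qed.

Lemma eq_monomial n c c' : (forall i, i < d -> c i = c' i) -> monomial n c = monomial n c'.
Proof. by move=> cc'; apply: eq_bigr => i _; rewrite cc'. Qed.

Lemma monomial0 n : monomial n (fun _ => 0) = 1.
Proof. by apply: big1 => i _; rewrite muln0. Qed.

Lemma monomial_shift n m c : monomial (n + m) c = monomial n (fun i => p ^ m * c i)%N.
Proof. by apply: eq_bigr => i _; rewrite expnD mulnA. Qed.

Lemma pi_monomialD n k c c' : k <= n + n + 1 ->
  pi k (monomial n (fun i => c i + c' i)%N) = pi k (monomial n c) * pi k (monomial n c').
Proof.
move=> kn; rewrite -gmulfM /monomial !gmulf_prod gmulfM !gmulf_prod -prodgM_commute.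
  by apply: eq_bigr => i _; rewrite mulnDr expgnDr gmulfM.
move=> i j _ _; apply: (@pi_commute n n); [exact: base_in|exact: base_in|].
exact: leq_trans kn (leq_addr _ _).
Qed.

Lemma pi_monomialX n k m c : k <= n + n + 1 ->
  pi k (monomial n c) ^+ m = pi k (monomial n (fun i => m * c i)%N).
Proof.
move=> kn; elim: m => [|m IHm].
  by rewrite expg0 (_ : monomial n _ = 1) ?gmulf1 // -(monomial0 n).
by rewrite expgS IHm -pi_monomialD.
Qed.

Lemma pi_monomial_expp n c :
  pi (n + n).+2 (monomial n c ^+ p) = pi (n + n).+2 (monomial n.+1 c).
Proof.
rewrite /monomial; elim: d => [|k IHk]; first by rewrite !big_ord0 expg1n.
rewrite !big_ord_recr /=; set x := \prod_(i < k) _ in IHk *; set y := b k ^+ _.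
have Px : P n x by apply: big_ind => [|u v|i _]; [exact: subgroup1|exact: subgroupM|exact: base_in].
have Py : P n y by exact: base_in.
have PR := filtration_commg uP Py Px.
transitivity (pi (n + n).+2 (x ^+ p * y ^+ p)).
  apply/pi_eqP; apply: (@filtration_expgM p _ P) => //.
    by apply: filtration_le PR; rewrite addn1 leq_addr.
  by move=> p2; move: PR; rewrite p2 eqxx !addn1.
rewrite [LHS]gmulfM IHk -[LHS]gmulfM; congr (pi _ (_ * _)).
by rewrite /y -expgnA mulnAC -expnSr.
Qed.

Lemma pi_monomial_exp n j c :
  pi (n + n + 1 + j) (monomial n c ^+ (p ^ j)) = pi (n + n + 1 + j) (monomial (n + j) c).
Proof.
elim: j => [|j IHj]; first by rewrite expn0 expg1 !addn0.
rewrite expnSr expgnA; have := pi_exp 1 IHj; rewrite !expn1 !addn1 !addnS => ->.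
apply: pi_le (pi_monomial_expp _ _).
by rewrite addnACA addSn !ltnS leq_add2l leq_addr.
Qed.

End Monomials.

Lemma prodg_delta (G : groupType) d (F : nat -> G) i : i < d ->
  \prod_(j < d) F j ^+ (i == j) = F i.
Proof.
elim: d => [//|d IHd]; rewrite ltnS leq_eqVlt big_ord_recr /= => /predU1P[->|id].
  rewrite eqxx expg1 big1 ?mul1g // => j _.
  by rewrite gtn_eqF // expg0.
by rewrite IHd // (ltn_eqF id) expg0 mulg1.
Qed.

Lemma monomial_delta d b n i : i < d -> monomial d b n (fun j => i == j) = b i ^+ (p ^ n).
Proof.
move=> id; rewrite -(prodg_delta (fun j => b j ^+ (p ^ n)) id).
by apply: eq_bigr => j _; rewrite expgnA.
Qed.

(** Generation and linear independence over F_p in U / P 1, written multiplicatively with natural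
    exponents. *)
Definition spans d (b : nat -> T) x := exists c, pi 1%N x = pi 1%N (monomial d b 0 c).
Definition independent d (b : nat -> T) :=
  forall c, P 1%N (monomial d b 0 c) -> forall i, i < d -> p %| c i.

Lemma pi1_expp x : pi 1%N x ^+ p = 1.
Proof. by rewrite -gmulfXn; apply/pi1; apply: PX; exact: filtration_all. Qed.

Lemma pi1_expmod x m : pi 1%N x ^+ (m %% p) = pi 1%N x ^+ m.
Proof. by rewrite [in RHS](divn_eq m p) expgnDr mulnC expgnA pi1_expp expg1n mul1g. Qed.

Lemma basis_of_seq (s : seq T) : exists d b, independent d b /\
  forall x, x \in s -> spans d b x.
Proof.
elim: s => [|x s [d [b [indb spanb]]]].
  by exists 0, (fun _ => 1); split.
have [spx|nspx] := pselect (spans d b x).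
  exists d, b; split=> // y; rewrite inE => /predU1P[->//|]; exact: spanb.
pose b' i := if i < d then b i else x.
have b'E c : monomial d.+1 b' 0 c = monomial d b 0 c * x ^+ c d.
  rewrite /monomial big_ord_recr /= {2}/b' ltnn mul1n; congr (_ * _).
  by apply: eq_bigr => i _; rewrite /b' ltn_ord.
exists d.+1, b'; split=> [c|y].
  rewrite b'E => Pc; have pcd : p %| c d.
    apply: contrapT => /negP npcd; apply: nspx.
    have cop : coprime (c d) p by rewrite coprime_sym prime_coprime.
    have [u cu] : exists u, (c d * u) %% p = 1%N.
      have cd0 : 0 < c d by case: (c d) npcd => //; rewrite dvdn0.
      have [u v uv _] := egcdnP p cd0; exists u.
      rewrite mulnC uv (eqP cop) modnMDl modn_small //; exact: prime_gt1.
    (* [u] inverts [c d] modulo p, and [p - 1] stands for -1: the relation is solved for [x]. *)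
    exists (fun i => (p - 1) * u * c i)%N.
    have /(canRL (mulKg _)) : pi 1%N (monomial d b 0 c) * pi 1%N x ^+ c d = 1.
      by rewrite -gmulfXn -gmulfM; apply/pi1.
    rewrite mulg1 => /(congr1 (fun z => z ^+ u)).
    rewrite -expgnA -pi1_expmod cu expg1 => ->.
    rewrite -pi_monomialX // expgnA; congr (_ ^+ u).
    by rewrite expgnFr // pi1_expp expg1 mul1g.
  have Pc' : P 1%N (monomial d b 0 c).
    have /dvdnP[k ck] := pcd; apply/pi1; move/pi1: Pc.
    by rewrite ck gmulfM mulnC expgnA !gmulfXn pi1_expp expg1n mulg1.
  move=> i; rewrite ltnS leq_eqVlt => /predU1P[->//|]; exact: indb.
rewrite inE => /predU1P[->|/spanb[c yc]].
  exists (fun j => d == j); congr (pi 1%N _).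
  by rewrite monomial_delta // expn0 expg1 /b' ltnn.
exists (fun j => if j < d then c j else 0).
rewrite yc b'E ltnn expg0 mulg1; congr (pi 1%N _).
by apply: eq_monomial => i ->.
Qed.

Lemma basis_exists : exists d b, independent d b /\ forall x, spans d b x.
Proof.
have /finite_fsetP[F FE] := filtration_fin uP.
have [d [b [indb spanb]]] := basis_of_seq [seq xget 1 A | A : set T <- F].
exists d, b; split=> // x; pose A := mulgs [set x] (P 1%N).
have FA : A \in F by have : [set` F] A by rewrite -FE; exists x.
have Ax : A (xget 1 A).
  by apply: xgetPex; exists x; rewrite /A coset_memE mulVg; exact: subgroup1.
have [c xc] : spans d b (xget 1 A) by apply: spanb; exact: map_f.
exists c; rewrite -xc; apply/pi_eqP; by rewrite -coset_memE.
Qed.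

Section Basis.
Variables (d : nat) (b : nat -> T).
Hypothesis indb : independent d b.
Hypothesis spanb : forall x, spans d b x.

Local Notation mon := (monomial d b).

Lemma monomial_gen1 n y : P n y -> exists c, pi n.+1 y = pi n.+1 (mon n c).
Proof.
elim: n y => [y _|n IHn y Py]; first exact: spanb.
have [z Pz /pi_eqP zy] := filtration_exp_surj uP Py.
have [c zc] := IHn _ Pz; exists c; rewrite -zy.
have := pi_exp 1 zc; rewrite expn1 addn1 => ->.
by apply: pi_le (pi_monomial_expp _ _ _ _); rewrite !ltnS leq_addr.
Qed.

(** Successive approximation: the error at stage [m] lies in [P (n + m)], where it is a monomial
    with exponents divisible by [p ^ m]. The bound on [m] lets exponents add. *)
Lemma monomial_gen n m y : m <= n.+1 -> P n y -> exists c, pi (n + m) y = pi (n + m) (mon n c).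
Proof.
elim: m => [|m IHm] mn Py.
  by exists (fun _ => 0); rewrite monomial0 gmulf1 addn0; apply/pi1.
have [c yc] := IHm (ltnW mn) Py; have /pi_eqP Pz := esym yc.
have [c' zc'] := monomial_gen1 Pz; exists (fun i => c i + p ^ m * c' i)%N.
rewrite pi_monomialD; last by rewrite addn1 addnS ltnS leq_add2l.
rewrite -monomial_shift addnS -zc' -gmulfM.
by rewrite mulVKg.
Qed.

Lemma monomial_indep1 n c : P n.+1 (mon n c) -> forall i, i < d -> p %| c i.
Proof.
elim: n => [|n IHn] Pc; first exact: indb.
apply: IHn; apply: (filtration_exp_inj uP); first exact: monomial_in.
apply/pi1; rewrite (pi_le _ (pi_monomial_expp d b n c)); first exact/pi1.
by rewrite !ltnS leq_addr.
Qed.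

Lemma monomial_indep n m c : P (n + m) (mon n c) -> forall i, i < d -> p ^ m %| c i.
Proof.
elim: m n c => [|m IHm] n c Pc i id; first by rewrite dvd1n.
have dvc j : j < d -> p %| c j.
  by apply: (@monomial_indep1 n); apply: filtration_le Pc; rewrite addnS ltnS leq_addr.
pose c' j := (c j %/ p)%N.
have cE j : j < d -> c j = (p ^ 1 * c' j)%N by move=> /dvc ?; rewrite expn1 mulnC divnK.
have Pc' : P (n + 1 + m) (mon (n + 1) c').
  by rewrite monomial_shift -(eq_monomial _ _ cE) -addnA add1n.
by rewrite expnS cE // expn1 dvdn_pmul2l //; apply: IHm Pc' _ id.
Qed.

(** With [monomial_gen], this identifies P n / P (n + m) with (Z / p ^ m) ^ d. *)
Lemma pi_monomial_eqP n m c c' : m <= n.+1 ->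
  pi (n + m) (mon n c) = pi (n + m) (mon n c') <->
  forall i, i < d -> c i = c' i %[mod p ^ m].
Proof.
move=> mn; have mn' : n + m <= n + n + 1 by rewrite -addnA leq_add2l addn1.
have shift0 f : pi (n + m) (mon n (fun i => p ^ m * f i)%N) = 1.
  by rewrite -monomial_shift; apply/pi1; exact: monomial_in.
split=> [cc' i id|cc']; last first.
  have modc f : pi (n + m) (mon n f) = pi (n + m) (mon n (fun i => f i %% p ^ m)%N).
    rewrite -[RHS]mulg1 -(shift0 (fun i => f i %/ p ^ m)%N) -pi_monomialD //.
    congr (pi _ _); apply: eq_monomial => i _; by rewrite addnC mulnC -divn_eq.
  by rewrite modc [RHS]modc; congr (pi _ _); apply: eq_monomial => i /cc'.
(* Exponents are natural numbers, so [p ^ m - 1] serves as -1 modulo [p ^ m]. *)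
have : pi (n + m) (mon n (fun i => c i + (p ^ m - 1) * c' i)%N) = 1.
  rewrite pi_monomialD // cc' -pi_monomialD // -(shift0 c'); congr (pi _ _).
  apply: eq_monomial => j _; by rewrite -{1}[c' j]mul1n -mulnDl subnKC.
move=> /pi1 /monomial_indep /(_ i id) /dvdnP[k ck].
apply/eqP; rewrite -(eqn_modDr ((p ^ m - 1) * c' i)) ck modnMl.
by rewrite -{1}[c' i]mul1n -mulnDl subnKC // modnMr.
Qed.

Lemma coord_ex x n : exists c, pi (n + n) (x ^+ (p ^ n)) = pi (n + n) (mon n c).
Proof.
apply: monomial_gen => //; rewrite -{1}[n]add0n; apply: expg_in.
exact: filtration_all.
Qed.

Definition coord x n : nat -> nat := projT1 (cid (coord_ex x n)).

Lemma coordP x n : pi (n + n) (x ^+ (p ^ n)) = pi (n + n) (mon n (coord x n)).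
Proof. exact: projT2 (cid (coord_ex x n)). Qed.

Lemma coord_mod x n m c : m <= n ->
  pi (n + m) (x ^+ (p ^ n)) = pi (n + m) (mon n c) <->
  forall i, i < d -> c i = coord x n i %[mod p ^ m].
Proof.
move=> mn; rewrite (pi_le _ (coordP x n)) ?leq_add2l // pi_monomial_eqP; last exact: leqW.
by split=> h i id; rewrite h.
Qed.

(** Taking p-th powers turns the monomial at level [n] into the one at level [n.+1] with the same
    exponents. *)
Lemma coord_compat x i n : i < d -> coord x n.+1 i = coord x n i %[mod p ^ n].
Proof.
move=> id; symmetry; move: i id; apply/coord_mod => //.
have := pi_exp 1 (coordP x n); rewrite expn1 -expgnA -expnSr addn1 -addSn => ->.
apply: pi_le (pi_monomial_expp _ _ _ _).
by rewrite addSn.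
Qed.

Fact plog_subproof x (i : 'I_d) n : coord x n.+1 i = coord x n i %[mod p ^ n].
Proof. exact: coord_compat. Qed.

Definition plog x : 'rV[padic p_pr]_d :=
  (\row_(i < d) mk_padic p_pr (plog_subproof x i))%R.

Lemma residue_plog x i n : residue (plog x ord0 i) n = (coord x n i %% p ^ n)%N.
Proof. by rewrite mxE. Qed.

Lemma plogP x n c :
  pi (n + n) (x ^+ (p ^ n)) = pi (n + n) (mon n c) <->
  forall i : 'I_d, c i = residue (plog x ord0 i) n %[mod p ^ n].
Proof.
rewrite coord_mod //; split=> h i; first by rewrite residue_plog modn_mod; exact: h.
by move=> id; have := h (Ordinal id); rewrite residue_plog modn_mod.
Qed.

(** Equal logarithms make the [p ^ n]-th powers congruent modulo P (2n); extracting roots gives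
    congruence of [x] and [y] modulo [P n], for every [n]. *)
Lemma plog_inj x y : plog x = plog y -> x = y.
Proof.
move=> xy; suff : x^-1 * y = 1 by move=> /(canRL (mulVKg _)); rewrite mulg1.
apply: (filtration_sep uP) => n; apply/pi_eqP; apply: (@pi_expg_inj _ n).
rewrite coordP; symmetry; apply/plogP => i; by rewrite -xy residue_plog modn_mod.
Qed.

Lemma residue_sum (I : Type) (r : seq I) (F : I -> padic p_pr) n :
  residue (\sum_(i <- r) F i)%R n = ((\sum_(i <- r) residue (F i) n) %% p ^ n)%N.
Proof.
elim/big_rec2: _ => [|i y1 y2 _]; first by rewrite residue0 mod0n.
by rewrite residueD => ->; rewrite modnDmr.
Qed.

Lemma plog_unique x (v : 'rV[padic p_pr]_d) :
  (forall n, exists c, pi (n + n) (x ^+ (p ^ n)) = pi (n + n) (mon n c) /\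
     forall i : 'I_d, c i = residue (v ord0 i) n %[mod p ^ n]) -> plog x = v.
Proof.
move=> h; apply/rowP => i; apply: padicP => n.
have [c [/plogP xc cv]] := h n.
by rewrite -residue_modn -xc cv residue_modn.
Qed.

(** Monomials take exponents indexed by all naturals but read only those below [d], so the default 0
    is never read. *)
Definition residues (v : 'rV[padic p_pr]_d) n : nat -> nat :=
  fun i => if (insub i : option 'I_d) is Some j then residue (v ord0 j) n else 0.

Lemma residuesE v n (i : 'I_d) : residues v n i = residue (v ord0 i) n.
Proof. by rewrite /residues valK. Qed.

Lemma plogE n x : pi (n + n) (x ^+ (p ^ n)) = pi (n + n) (mon n (residues (plog x) n)).
Proof. by apply/plogP => i; rewrite residuesE. Qed.

Lemma plog1 : plog 1 = 0%R.
Proof.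
apply: plog_unique => n; exists (fun _ => 0); split=> [|i]; last by rewrite mxE residue0.
by rewrite expg1n monomial0.
Qed.

Lemma plog_base (i : 'I_d) : plog (b i) = (\row_j (i == j)%:R)%R.
Proof.
apply: plog_unique => n; exists (fun j => (i : nat) == j); split=> [|j].
  by rewrite monomial_delta.
by rewrite mxE residue_nat modn_mod.
Qed.

Definition adjoint g : 'M[padic p_pr]_d := (\matrix_(i, j) plog (b i ^ g) ord0 j)%R.

Lemma adjointE g (i j : 'I_d) : adjoint g i j = plog (b i ^ g) ord0 j.
Proof. exact: mxE. Qed.

(** Conjugate the monomial for [x ^+ (p ^ n)]: each factor becomes a power of
    [(b i ^ g) ^+ (p ^ n)], whose coordinates are known, and coordinates are additive modulo P
    (2n). *)
Lemma plog_conj x g : plog (x ^ g) = (plog x *m adjoint g)%R.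
Proof.
apply: plog_unique => n.
exists (fun j => \sum_(i < d) residues (plog x) n i * residues (plog (b i ^ g)) n j)%N.
split=> [|j]; last first.
  rewrite mxE residue_sum modn_mod -[LHS]modn_summ; congr (_ %% _).
  by apply: eq_bigr => i _; rewrite adjointE residueM !residuesE.
have mem k y : P n ((y ^+ (p ^ n)) ^+ k).
  apply: subgroupX => //; rewrite -{1}[n]add0n; apply: expg_in; exact: filtration_all.
rewrite -conjXg gmulfJ plogE -gmulfJ.
rewrite (_ : mon n _ ^ g = \prod_(i < d) (b i ^ g) ^+ (p ^ n * residues (plog x) n i)); last first.
  by rewrite conjg_prod; apply: eq_bigr => i _; rewrite conjXg.
rewrite !gmulf_prod.
have -> k : \prod_(i < k) pi (n + n) ((b i ^ g) ^+ (p ^ n * residues (plog x) n i)) =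
  pi (n + n)
    (mon n (fun j => \sum_(i < k) residues (plog x) n i * residues (plog (b i ^ g)) n j)%N).
  elim: k => [|k IHk].
    rewrite big_ord0 (_ : mon n _ = 1) ?gmulf1 // -(monomial0 d b n).
    by apply: eq_monomial => j _; rewrite big_ord0.
  rewrite big_ord_recr /= IHk expgnA gmulfXn plogE pi_monomialX ?leq_addr //.
  rewrite -pi_monomialD ?leq_addr //.
  by congr (pi _ _); apply: eq_monomial => j _; rewrite big_ord_recr.
by rewrite -gmulf_prod.
Qed.

Lemma adjointM g h : adjoint (g * h) = (adjoint g *m adjoint h)%R.
Proof.
apply/row_matrixP => i; rewrite row_mul.
have rowA k : row i (adjoint k) = plog (b i ^ k) by apply/rowP => j; rewrite !mxE.
by rewrite !rowA conjgM plog_conj.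
Qed.

Lemma adjoint1 : adjoint 1 = 1%:M%R.
Proof. by apply/matrixP => i j; rewrite mxE conjg1 plog_base !mxE. Qed.

Lemma padic_eq_mod (x y : padic p_pr) n : residue x n = residue y n ->
  exists z, (x = y + (p ^ n)%:R * z)%R.
Proof.
move=> xy; have : residue (x - y)%R n = 0.
  have : residue (x - y + y)%R n = residue x n by rewrite GRing.subrK.
  rewrite residueD xy -{2}[residue y n]residue_modn -{2}[residue y n]add0n => /eqP.
  by rewrite eqn_modDr mod0n residue_modn => /eqP.
by move=> /padic_divp[z xyz]; exists z; rewrite -xyz GRing.addrC GRing.subrK.
Qed.

(** [b i, g] lies in [P e.+1], so [b i ^ g] and [b i] have the same coordinates modulo
    [p ^ e.+1]. *)
Lemma adjoint_mod g : exists X : 'M[padic p_pr]_d,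
  adjoint g = (1%:M + (p ^ e.+1)%:R *: X)%R.
Proof.
have div (i j : 'I_d) : exists y : padic p_pr,
    (adjoint g i j = (1%:M : 'M_d) i j + (p ^ e.+1)%:R * y)%R.
  apply: padic_eq_mod; rewrite adjointE [in RHS]mxE residue_nat.
  have : pi (e.+1 + e.+1) ((b i ^ g) ^+ (p ^ e.+1)) =
         pi (e.+1 + e.+1) (mon e.+1 (fun j => (i : nat) == j)).
    rewrite monomial_delta //; apply: pi_exp; symmetry; apply/pi_eqP.
    exact: (filtration_commg uP (filtration_all (b i)) (filtration_all g)).
  by move=> /plogP /(_ j) ->; rewrite residue_modn.
exists (\matrix_(i, j) projT1 (cid (div i j)))%R; apply/matrixP => i j.
rewrite [in RHS]mxE; rewrite [X in (_ + X)%R]mxE [X in (_ * X)%R]mxE.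
exact: (projT2 (cid (div i j))).
Qed.

(** If [w] has coordinates [c] in P n / P (2n), its logarithm is [p ^ n * c] modulo [p ^ (2n)],
    while [plog x - plog y] is [c] modulo [p ^ n]. *)
Lemma plog_diff x y n : exists r : 'rV[padic p_pr]_d,
  ((p ^ n)%:R *: (plog x - plog y) =
   plog (x ^+ (p ^ n) * (y ^+ (p ^ n))^-1) + (p ^ (n + n))%:R *: r)%R.
Proof.
set w := _ * _.
have inP z : P n (z ^+ (p ^ n)).
  by rewrite -{1}[n]add0n; apply: expg_in; exact: filtration_all.
have Pw : P n w by apply: subgroupM => //; apply: subgroupV.
have [c wc] := monomial_gen (leqnSn n) Pw.
have wlog : pi (n + n + (n + n)) (w ^+ (p ^ (n + n))) =
            pi (n + n + (n + n)) (mon (n + n) (fun i => p ^ n * c i)%N).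
  rewrite (pi_exp (n + n) wc) -monomial_shift -[X in _ = pi _ (mon X c)]addnA.
  by apply: pi_le (pi_monomial_exp d b n (n + n) c); rewrite leq_add2r addn1.
have xyw : forall i : 'I_d,
    residue (plog x ord0 i) n = (c i + residue (plog y ord0 i) n)%N %[mod p ^ n].
  have : pi (n + n) (x ^+ (p ^ n)) =
         pi (n + n) (mon n (fun i => c i + residues (plog y) n i)%N).
    rewrite pi_monomialD ?leq_addr // -wc -plogE -gmulfM; congr (pi _ _).
    by rewrite /w mulgVK.
  by move=> /plogP h i; rewrite -h residuesE.
have div (i : 'I_d) : exists z : padic p_pr, ((p ^ n)%:R * plog x ord0 i =
    (plog w ord0 i + (p ^ n)%:R * plog y ord0 i) + (p ^ (n + n))%:R * z)%R.
  apply: padic_eq_mod; rewrite residueD !residueM !residue_nat.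
  move/plogP: wlog => /(_ i) wc'; rewrite -[residue (plog w _ _) _]residue_modn -wc'.
  rewrite !modnMml modnDm -mulnDr expnD -!muln_modr; congr (_ * _)%N.
  rewrite residue_mod ?leq_addr // -modnDmr residue_mod ?leq_addr //.
  by rewrite -xyw residue_modn.
move: (plog x) (plog y) (plog w) div => X Y W div.
exists (\row_i projT1 (cid (div i)))%R; apply/rowP => i.
rewrite !mxE GRing.mulrBr; case: (cid (div i)) => z /= ->.
by rewrite GRing.addrAC GRing.addrK.
Qed.

End Basis.
End Logarithm.

Record is_padic_log (p : nat) (p_pr : prime p) (T : groupType) d
    (L : T -> 'rV[padic p_pr]_d) (A : T -> 'M[padic p_pr]_d) : Prop := {
  padic_log_inj : injective L;
  padic_log1 : L 1 = 0%R;
  padic_log_conj : forall x g, L (x ^ g) = (L x *m A g)%R;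
  padic_log_adM : forall g h, A (g * h) = (A g *m A h)%R;
  padic_log_ad1 : A 1 = (1%:M)%R;
  padic_log_ad_mod : forall g, exists X : 'M_d,
    A g = (1%:M + (p ^ (p == 2).+1)%:R *: X)%R;
  padic_log_diff : forall x y n, exists r : 'rV_d,
    ((p ^ n)%:R *: (L x - L y) =
     L (x ^+ (p ^ n)%N * (y ^+ (p ^ n)%N)^-1)%g + (p ^ (n + n))%:R *: r)%R
}.

Lemma padic_log_exists (p : nat) (p_pr : prime p) (T : groupType) (P : nat -> set T) :
  uniform_filtration p P ->
  exists d (L : T -> 'rV[padic p_pr]_d) (A : T -> 'M[padic p_pr]_d), is_padic_log L A.
Proof.
move=> uP; pose nP := filtration_normal uP.
pose pi n : UMagmaMorphism.type T (quotient_group (nP n)) := quotient_map (nP n).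
have pi1 n x : pi n x = 1 <-> P n x.
  split=> [/eqP|Nx].
    by rewrite -(gmulf1 (s := pi n)) eq_sym pi_eqmod => /asboolP; rewrite invg1 mul1g.
  by rewrite -[RHS](gmulf1 (s := pi n)); symmetry; apply: pi_eq; rewrite invg1 mul1g.
have [d [b [indb spanb]]] := basis_exists p_pr uP pi1.
exists d, (plog p_pr uP pi1 indb spanb), (adjoint p_pr uP pi1 indb spanb); split.
- exact: plog_inj.
- exact: plog1.
- exact: plog_conj.
- exact: adjointM.
- exact: adjoint1.
- exact: adjoint_mod.
- exact: plog_diff.
Qed.

Local Close Scope group_scope.
Local Close Scope classical_set_scope.

(** * Representations in which roots of eigenvalues are unique *)

Import GRing.Theory.
Local Open Scope ring_scope.

Lemma irreducible_factor (K : fieldType) (q : {poly K}) : (1 < size q)%N ->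
  exists2 r : {poly K}, irreducible_poly r & r %| q.
Proof.
have [n] := ubnP (size q); elim: n q => // n IHn q; rewrite ltnS => qn q1.
have [irr|nirr] := pselect (irreducible_poly q); first by exists q.
have [s [s1 sq nsq]] : exists s : {poly K}, [/\ size s != 1%N, s %| q & ~~ (s %= q)].
  apply: contrapT => h; apply: nirr; split=> // s s1 sq.
  by apply: contrapT => /negP nsq; apply: h; exists s.
have q0 : q != 0 by rewrite -size_poly_gt0; apply: ltn_trans q1.
have s0 : s != 0 by apply: contraNneq q0 => s0; rewrite s0 dvd0p in sq.
have ltsq : (size s < size q)%N.
  by rewrite ltn_neqAle dvdp_leq // andbT; rewrite (dvdp_size_eqp sq).
have [] := IHn s; first exact: leq_trans ltsq qn.
  by rewrite ltn_neqAle eq_sym s1 size_poly_gt0.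
by move=> r irr rs; exists r => //; apply: dvdp_trans sq.
Qed.

Lemma extension_root (K : fieldType) (q : {poly K}) : (1 < size q)%N ->
  exists (L : fieldType) (f : {rmorphism K -> L}) x, root (map_poly f q) x.
Proof.
move=> /irreducible_factor[r irr rq].
have [L _ [z rz _]] := irredp_FAdjoin irr.
exists L, (in_alg L), z; apply: root_dvdp rz; by rewrite (dvdp_map (in_alg L)).
Qed.

(** In a basis of [W] the action of [A] is a square matrix [A']; adjoin a root of its characteristic
    polynomial. *)
Lemma extension_eigenvector (K : fieldType) r (A : 'M[K]_r) m (W : 'M_(m, r)) :
  W != 0 -> stablemx W A ->
  exists (L : fieldType) (f : {rmorphism K -> L}) a (u : 'rV_r),
    [/\ u != 0, (u <= map_mx f W)%MS & u *m map_mx f A = a *: u].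
Proof.
move=> W0 stW; pose B := row_base W; pose A' := B *m A *m pinvmx B.
have stB : stablemx B A by rewrite stablemx_row_base.
have A'B : A' *m B = B *m A by rewrite mulmxKpV.
have szA' : (1 < size (char_poly A'))%N by rewrite size_char_poly ltnS lt0n mxrank_eq0.
have [L [f [a]]] := extension_root szA'.
rewrite map_char_poly -eigenvalue_root_char => /eigenvalueP[v va v0].
exists L, f, a, (v *m map_mx f B); split.
- apply: contra_neq v0 => vB0; apply: (row_free_inj (A := map_mx f B)).
    by rewrite row_free_map row_base_free.
  by rewrite vB0 mul0mx.
- by rewrite (submx_trans (submxMl _ _)) // map_submx eq_row_base.
- by rewrite -mulmxA -map_mxM -A'B map_mxM mulmxA va scalemxAl.
Qed.

(** The basis is chosen inside [X], so a property of the span can be checked on members of [X]. *)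
Lemma span_basis (K : fieldType) r (X : set 'rV[K]_r) :
  exists m (W : 'M_(m, r)), [/\ row_free W, (forall i, X (row i W)) &
    forall x, X x -> (x <= W)%MS].
Proof.
pose ok m := `[< exists W : 'M_(m, r), row_free W /\ forall i, X (row i W) >].
have ex : exists m, ok m.
  exists 0%N; apply/asboolP; exists 0; split; first by rewrite /row_free mxrank0.
  by case.
have bd m : ok m -> (m <= r)%N.
  by move=> /asboolP[W [/eqP rW _]]; have := rank_leq_col W; rewrite rW.
have [m /asboolP[W [frW XW]] maxm] := ex_maxnP ex bd.
exists m, W; split=> // x Xx; apply: contrapT => /negP nxW.
suff /maxm : ok m.+1 by rewrite ltnn.
rewrite -addn1; apply/asboolP; exists (col_mx W x); split; last first.
  move=> i; rewrite -[i]splitK; case: (fintype.split i) => j /=; first by rewrite rowKu.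
  by rewrite rowKd row_id.
have x0 : \rank x = 1%N by rewrite rank_rV (contraNneq _ nxW) // => ->; rewrite sub0mx.
rewrite /row_free -addsmxE.
have : (W :&: x)%MS = 0.
  apply/eqP; rewrite -submx0; apply/rV_subP => v; rewrite sub_capmx => /andP[vW].
  move=> /sub_rVP[a va]; rewrite va in vW *; have [->|a0] := eqVneq a 0.
    by rewrite scale0r sub0mx.
  by case/negP: nxW; rewrite -(eqmx_scale x a0).
by move=> /mxrank_disjoint_sum ->; rewrite (eqP frW) x0.
Qed.

(* Eigenvectors with pairwise distinct systems of eigenvalues are independent. *)
Lemma weights_pigeonhole (K : fieldType) r (I : Type) (A : I -> 'M[K]_r)
    (v : nat -> 'rV_r) (chi : nat -> I -> K) :
  (forall k, v k != 0) -> (forall k i, v k *m A i = chi k i *: v k) ->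
  exists k l, [/\ (k < l)%N & forall i, chi k i = chi l i].
Proof.
move=> v0 vA; apply: contrapT => nkl.
have diff k l : (k < l)%N -> exists i, chi k i != chi l i.
  move=> kl; apply: contrapT => all_eq; apply: nkl; exists k, l; split=> // i.
  by apply/eqP; apply: contrapT => /negP ne; apply: all_eq; exists i.
have indep n (c : nat -> K) :
    \sum_(k < n) c k *: v k = 0 -> forall k, (k < n)%N -> c k = 0.
  elim: n c => [//|n IHn] c sum0.
  have ck k : (k < n)%N -> c k = 0.
    move=> kn; have [i chi_i] := diff _ _ kn.
    suff s0 : \sum_(k < n) (c k * (chi k i - chi n i)) *: v k = 0.
      have /eqP := IHn (fun k => c k * (chi k i - chi n i)) s0 k kn.
      by rewrite mulf_eq0 subr_eq0 (negPf chi_i) orbF => /eqP.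
    (* This operator kills the last vector and multiplies the [k]-th by a nonzero scalar, by the
       choice of [i]. *)
    have : (\sum_(k < n.+1) c k *: v k) *m (A i - (chi n i)%:M) = 0 by rewrite sum0 mul0mx.
    have vE k' : v k' *m (A i - (chi n i)%:M) = (chi k' i - chi n i) *: v k'.
      by rewrite mulmxBr vA mul_mx_scalar scalerBl.
    rewrite mulmx_suml big_ord_recr /= -[X in _ + X]scalemxAl vE subrr scale0r scaler0 addr0.
    move=> h; rewrite -[RHS]h; apply: eq_bigr => k' _.
    by rewrite -[RHS]scalemxAl vE scalerA.
  move=> k; rewrite ltnS leq_eqVlt => /predU1P[->|]; last exact: ck.
  move: sum0; rewrite big_ord_recr /= big1 ?add0r => [|k' _]; last by rewrite ck ?scale0r.
  by move/eqP; rewrite scaler_eq0 (negPf (v0 n)) orbF => /eqP.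
have : row_free (\matrix_(k < r.+1) v k).
  apply: inj_row_free => w; rewrite mulmx_sum_row => w0.
  apply/rowP => k; rewrite mxE.
  have := indep r.+1 (fun k => if insub k is Some j then w 0 j else 0).
  move=> /(_ _ k (ltn_ord k)); rewrite valK; apply.
  by rewrite -[RHS]w0; apply: eq_bigr => j _; rewrite valK rowK.
by rewrite /row_free => /eqP rk; have := rank_leq_col (\matrix_(k < r.+1) v k); rewrite rk ltnn.
Qed.

Lemma eigenvector_exp (K : fieldType) r (A : 'M[K]_r.+1) (w : 'rV_r.+1) c m :
  w *m A = c *: w -> w *m A ^+ m = c ^+ m *: w.
Proof.
move=> wA; elim: m => [|m IHm]; first by rewrite !expr0 mulmx1 scale1r.
by rewrite !exprSr mulmxA IHm -scalemxAl wA scalerA.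
Qed.

Section Representations.
Variables (T : groupType) (G : set T).
Hypothesis sG : is_subgroup G.

(* The last field says that the eigenvalues of [G] lie in a set in which roots
   are unique; for the matrices considered below, this set consists of the
   elements congruent to 1 modulo [p] (modulo 4 if [p = 2]). *)
Record good_rep (K : fieldType) r (rho : T -> 'M[K]_r) : Prop := {
  rep_char0 : forall n, n.+1%:R != 0 :> K;
  rep1 : rho 1%g = 1%:M;
  repM : forall g h, G g -> G h -> rho (g * h)%g = rho g *m rho h;
  rep_root_unique : forall (L : fieldType) (f : {rmorphism K -> L}) g h a b n,
    G g -> G h -> eigenvalue (map_mx f (rho g)) a -> eigenvalue (map_mx f (rho h)) b ->
    a ^+ n.+1 = b ^+ n.+1 -> a = b
}.

Section GoodRep.
Variables (K : fieldType) (r : nat) (rho : T -> 'M[K]_r).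
Hypothesis rhoP : good_rep rho.

Lemma good_rep_map (L : fieldType) (f : {rmorphism K -> L}) :
  good_rep (fun g => map_mx f (rho g)).
Proof.
case: rhoP => c0 r1 rM ru; split.
- by move=> n; rewrite -(rmorph_nat f) fmorph_eq0.
- by rewrite r1 map_mx1.
- by move=> g h Gg Gh; rewrite rM // map_mxM.
- move=> M f' g h a b n Gg Gh; rewrite -!map_mx_comp => ea eb ab.
  exact: (ru M (f' \o f) g h a b n).
Qed.

(** Covers both stable subspaces and changes of basis: an eigenvector of [rho' g] times [W] is one
    of [rho g]. *)
Lemma good_rep_sub m (W : 'M_(m, r)) (rho' : T -> 'M_m) :
  row_free W -> (forall g, G g -> rho' g *m W = W *m rho g) -> rho' 1%g = 1%:M ->
  good_rep rho'.
Proof.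
case: rhoP => c0 r1 rM ru frW rho'W rho'1; split=> //.
  move=> g h Gg Gh; have Ggh := subgroupM sG Gg Gh; apply: (row_free_inj frW) => /=.
  by rewrite rho'W // rM // -mulmxA rho'W // !mulmxA rho'W.
have eigW (L : fieldType) (f : {rmorphism K -> L}) g a : G g ->
    eigenvalue (map_mx f (rho' g)) a -> eigenvalue (map_mx f (rho g)) a.
  move=> Gg /eigenvalueP[v va v0]; apply/eigenvalueP; exists (v *m map_mx f W).
    by rewrite -mulmxA -map_mxM -rho'W // map_mxM mulmxA va scalemxAl.
  apply: contra_neq v0 => vW0; apply: (row_free_inj (A := map_mx f W)).
    by rewrite row_free_map.
  by rewrite vW0 mul0mx.
move=> L f g h a b n Gg Gh /eigW ea /eigW eb.
by apply: ru; [exact: Gg|exact: Gh|exact: ea|exact: eb].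
Qed.

Lemma good_repV g : G g -> rho g *m rho g^-1%g = 1%:M.
Proof.
by move=> Gg; rewrite -(repM rhoP) ?mulgV ?(rep1 rhoP) //; exact: subgroupV.
Qed.

Lemma good_rep_mul_eq0 g m (v : 'M_(m, r)) : G g -> v *m rho g = 0 -> v = 0.
Proof.
by move=> Gg v0; rewrite -[v]mulmx1 -(good_repV Gg) mulmxA v0 mul0mx.
Qed.
End GoodRep.

Lemma good_repX (K : fieldType) r (rho : T -> 'M[K]_r.+1) g n : good_rep rho -> G g ->
  rho (g ^+ n)%g = rho g ^+ n.
Proof.
move=> rhoP Gg; elim: n => [|n IHn]; first by rewrite expg0 (rep1 rhoP).
by rewrite expgS exprS (repM rhoP) ?IHn //; exact: subgroupX.
Qed.

(** Let [mu] be the eigenvalue of [g ^+ n.+1] on [v], and [nu] an eigenvalue of [g] with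
    [nu ^+ n.+1 = mu]. Then [A ^+ n.+1 - mu] is [A - nu] times a sum [S]. An eigenvalue of [g] on
    the kernel of [S] would have the same power as [nu], hence equal [nu]; but there [S] acts as
    [n.+1 * nu ^+ n], which is nonzero. So [S] is injective and [A - nu] kills [v]. *)
Lemma stable_root (K : fieldType) r (rho : T -> 'M[K]_r) g n (v : 'rV_r) :
  good_rep rho -> G g -> stablemx v (rho (g ^+ n.+1)%g) -> stablemx v (rho g).
Proof.
case: r rho v => [|r] rho v rhoP Gg; first by move=> _; rewrite [v]thinmx0 mul0mx sub0mx.
rewrite good_repX // => /sub_rVP[mu vmu].
have [->|v0] := eqVneq v 0; first by rewrite mul0mx sub0mx.
pose A := rho g; pose E := eigenspace (A ^+ n.+1) mu.
have vE : (v <= E)%MS by apply/eigenspaceP.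
have E0 : E != 0 by apply: contraNneq v0 => E0; rewrite -submx0 -E0.
have stE : stablemx E A.
  by apply: comm_mx_stable_eigenspace; exact: commr_sym (commrX _ (commr_refl _)).
have [L [f [nu [u [u0 uE uA]]]]] := extension_eigenvector E0 stE.
have rhofP := good_rep_map rhoP f.
pose A' := map_mx f A; rewrite -/A' in uA.
have fA n' : map_mx f (A ^+ n') = A' ^+ n' by rewrite rmorphXn.
have numu : nu ^+ n.+1 = f mu.
  have : u *m A' ^+ n.+1 = f mu *: u.
    have [w ->] := submxP uE; rewrite -mulmxA -fA -map_mxM.
    have -> : E *m A ^+ n.+1 = mu *: E by apply/eigenspaceP.
    by rewrite map_mxZ scalemxAr.
  rewrite (eigenvector_exp _ uA) => /eqP; rewrite -subr_eq0 -scalerBl scaler_eq0 (negPf u0) orbF.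
  by rewrite subr_eq0 => /eqP.
pose S := \sum_(i < n.+1) A' ^+ (n - i) * nu%:M ^+ i.
have comA : GRing.comm A' nu%:M by rewrite /GRing.comm -!mulmxE scalar_mxC.
have comS : comm_mx S A'.
  apply: commr_sym; apply: commr_sum => i _.
  by apply: commrM; apply: commrX; [exact: commr_refl|exact: comA].
have NS : (A' - nu%:M) *m S = A' ^+ n.+1 - (f mu)%:M.
  by rewrite mulmxE -numu rmorphXn; apply: esym; exact: subrXX_comm n.+1 comA.
have kerS0 : kermx S = 0.
  apply: contrapT => /eqP kerS; have stS : stablemx (kermx S) A' by exact: comm_mx_stable_ker.
  have [M [f' [nu' [w [w0 wS wA]]]]] := extension_eigenvector kerS stS.
  have rootA : eigenvalue (map_mx (f' \o f) (rho g)) nu'.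
    by apply/eigenvalueP; exists w => //; rewrite map_mx_comp.
  have rootA' : eigenvalue (map_mx (f' \o f) (rho g)) (f' nu).
    apply/eigenvalueP; exists (map_mx f' u); rewrite ?map_mx_eq0 //.
    by rewrite map_mx_comp -map_mxM uA map_mxZ.
  have wS0 : w *m map_mx f' S = 0.
    have [z ->] := submxP wS; by rewrite -mulmxA -map_mxM mulmx_ker map_mx0 mulmx0.
  have wN : w *m map_mx f' ((A' - nu%:M) *m S) = (nu' - f' nu) *: (w *m map_mx f' S).
    rewrite map_mxM mulmxA map_mxB mulmxBr wA map_scalar_mx mul_mx_scalar -scalerBl.
    by rewrite -scalemxAl.
  have nu'E : nu' ^+ n.+1 = f' nu ^+ n.+1.
    move: wN; rewrite wS0 scaler0 NS map_mxB map_scalar_mx mulmxBr mul_mx_scalar.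
    rewrite rmorphXn /= (eigenvector_exp _ wA) -scalerBl => /eqP.
    by rewrite scaler_eq0 (negPf w0) orbF subr_eq0 -numu rmorphXn => /eqP.
  have nuE : nu' = f' nu := rep_root_unique rhoP Gg Gg rootA rootA' nu'E.
  have wS1 : w *m map_mx f' S = (n.+1%:R * nu' ^+ n) *: w.
    rewrite raddf_sum mulmx_sumr (eq_bigr (fun => nu' ^+ n *: w)).
      by rewrite sumr_const card_ord scalerMnl mulr_natl.
    move=> i _ /=; have -> : map_mx f' (A' ^+ (n - i) * nu%:M ^+ i) =
        map_mx f' A' ^+ (n - i) *m (nu' ^+ i)%:M.
      by rewrite rmorphM !rmorphXn /= map_scalar_mx -nuE mulmxE.
    rewrite mulmxA (eigenvector_exp _ wA) mul_mx_scalar scalerA.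
    by rewrite -exprD subnKC // -ltnS.
  move/eqP: wS1; rewrite wS0 eq_sym scaler_eq0 (negPf w0) orbF mulf_eq0.
  have rhoff := good_rep_map rhoP (f' \o f).
  rewrite (negPf (rep_char0 rhoff n)) /= expf_eq0 => /andP[_ /eqP nu'0].
  case/eqP: w0; apply: (good_rep_mul_eq0 rhoff Gg).
  by rewrite map_mx_comp wA nu'0 scale0r.
have : (map_mx f v *m (A' - nu%:M) <= kermx S)%MS.
  rewrite sub_kermx -mulmxA NS mulmxBr -fA -map_mxM vmu mul_mx_scalar map_mxZ.
  by rewrite subrr.
rewrite kerS0 submx0 mulmxBr subr_eq0 mul_mx_scalar => /eqP vnu.
by rewrite -(map_submx f) map_mxM -/A vnu scalemx_sub.
Qed.

End Representations.

(** If some matrix is not scalar, it has after an extension a proper nonzero eigenspace, which all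
    the others stabilise. *)
Lemma commuting_eigenvector r : (0 < r)%N ->
  forall (K : fieldType) (I : Type) (A : I -> 'M[K]_r),
  (forall i j, comm_mx (A i) (A j)) ->
  exists (L : fieldType) (f : {rmorphism K -> L}) (v : 'rV_r),
    v != 0 /\ forall i, stablemx v (map_mx f (A i)).
Proof.
have [n] := ubnP r; elim: n r => // n IHn r; rewrite ltnS => rn r0 K I A comA.
have [sc|/existsNP[i0 nsc]] := pselect (forall i, is_scalar_mx (A i)).
  exists K, idfun, (delta_mx 0 (Ordinal r0)); split.
    by apply/eqP => /rowP /(_ (Ordinal r0)) /eqP; rewrite !mxE !eqxx oner_eq0.
  move=> i; have /is_scalar_mxP[c ->] := sc i.
  by rewrite map_scalar_mx mul_mx_scalar scalemx_sub.
have idr0 : (1%:M : 'M[K]_r) != 0 by rewrite -mxrank_eq0 mxrank1 -lt0n.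
have st1 : stablemx 1%:M (A i0) by rewrite submx1.
have [L [f [a [u [u0 _ ua]]]]] := extension_eigenvector idr0 st1.
pose E := eigenspace (map_mx f (A i0)) a.
have uE : (u <= E)%MS by apply/eigenspaceP.
have rkE0 : (0 < \rank E)%N.
  by rewrite lt0n mxrank_eq0; apply: contraNneq u0 => E0; rewrite -submx0 -E0.
have rkEr : (\rank E < r)%N.
  rewrite ltn_neqAle rank_leq_row andbT; apply: contra_notN nsc => fullE.
  rewrite -(map_mx_is_scalar f); apply/is_scalar_mxP; exists a.
  have /eigenspaceP : (1%:M <= E)%MS by rewrite sub1mx.
  by rewrite mul1mx scalemx1.
have [W [frW stW]] : exists W : 'M_(\rank E, r),
    row_free W /\ forall i, stablemx W (map_mx f (A i)).
  exists (row_base E); split=> [|i]; first exact: row_base_free.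
  rewrite stablemx_row_base; apply: comm_mx_stable_eigenspace.
  by rewrite /matrix.comm_mx -!map_mxM (comA i0 i).
have [B BW] : exists B, forall i, B i *m W = W *m map_mx f (A i).
  by exists (fun i => W *m map_mx f (A i) *m pinvmx W) => i; rewrite mulmxKpV.
have comB i j : comm_mx (B i) (B j).
  apply: (row_free_inj frW).
  rewrite /= -!mulmxA !BW !mulmxA !BW -!mulmxA -!map_mxM.
  by rewrite (comA i j).
have [M [f' [v [v0 vB]]]] := IHn _ (leq_trans rkEr rn) rkE0 L I B comB.
exists M, (f' \o f), (v *m map_mx f' W); split.
  apply: contra_neq v0 => vW0; apply: (row_free_inj (A := map_mx f' W)).
    by rewrite row_free_map.
  by rewrite vW0 mul0mx.
move=> i; rewrite [map_mx (f' \o f) _]map_mx_comp -mulmxA -map_mxM -BW map_mxM mulmxA.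
by apply: submxMr; exact: vB.
Qed.

(** * Solvable normal subgroups act by scalars on irreducible representations *)

Section Irreducible.
Variables (T : groupType) (G : set T).
Hypothesis sG : is_subgroup G.

(** Subspaces are tested over all extensions, which stands for irreducibility over an algebraic
    closure. *)
Definition absolutely_irreducible (K : fieldType) r (rho : T -> 'M[K]_r) : Prop :=
  forall (L : fieldType) (f : {rmorphism K -> L}) m (W : 'M_(m, r)),
  (forall g, G g -> stablemx W (map_mx f (rho g))) -> W = 0 \/ row_full W.

Section Scalars.
Variables (K : fieldType) (r : nat) (rho : T -> 'M[K]_r).
Hypothesis rhoP : good_rep G rho.
Hypothesis r_gt0 : (0 < r)%N.

(** If [x, y] acts as [c], then [rho x] multiplies eigenvalues of [rho y] by [c]. There are finitely
    many of these, so [c] is a root of unity; then [c * a] and [a] have a common power and are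
    equal. *)
Lemma scalar_commutator_commute x y : G x -> G y -> is_scalar_mx (rho [~ x, y]%g) ->
  comm_mx (rho x) (rho y).
Proof.
move=> Gx Gy /is_scalar_mxP[c cE].
have XY : rho x *m rho y = c *: (rho y *m rho x).
  rewrite -!(repM rhoP) // (commgC x y) [LHS](repM rhoP) ?cE ?mul_mx_scalar //.
    exact: subgroupM.
  exact: subgroupR.
have [L [f [a [u [u0 _ uY]]]]] : exists (L : fieldType) (f : {rmorphism K -> L}) a (u : 'rV_r),
    [/\ u != 0, (u <= map_mx f 1%:M)%MS & u *m map_mx f (rho y) = a *: u].
  apply: extension_eigenvector; last by rewrite submx1.
  by rewrite -mxrank_eq0 mxrank1 -lt0n.
have rhofP := good_rep_map rhoP f.
pose X := map_mx f (rho x); pose Y := map_mx f (rho y).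
have XYf : X *m Y = f c *: (Y *m X) by rewrite -!map_mxM XY map_mxZ.
pose v k := iter k (mulmx^~ X) u.
have v0 k : v k != 0.
  elim: k => [//|k IHk]; apply: contra_neq IHk => vX0.
  exact: (good_rep_mul_eq0 sG rhofP Gx vX0).
have vY k : v k *m Y = (f c ^+ k * a) *: v k.
  elim: k => [|k IHk]; first by rewrite expr0 mul1r.
  rewrite /= -mulmxA XYf -scalemxAr mulmxA IHk -scalemxAl scalerA.
  by rewrite exprS mulrA.
have a0 : a != 0.
  apply: contra_neq u0 => a0; apply: (good_rep_mul_eq0 sG rhofP Gy).
  by rewrite uY a0 scale0r.
have [k [l [kl ckl]]] := weights_pigeonhole (A := fun _ : unit => Y)
   (chi := fun k _ => f c ^+ k * a) v0 (fun k _ => vY k).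
have {}ckl := mulIf a0 (ckl tt).
have c0 : f c != 0.
  apply: contraNneq (v0 1%N) => c0; have := vY 1%N; rewrite c0 expr1 mul0r scale0r.
  by move=> /(good_rep_mul_eq0 sG rhofP Gy) /= ->.
have cm : f c ^+ (l - k.+1).+1 = 1.
  apply: (mulfI (expf_neq0 k c0)); rewrite mulr1 -exprD ckl; congr (_ ^+ _).
  by rewrite subnSK // subnKC // ltnW.
have ca : f c * a = a.
  apply: (rep_root_unique rhofP (f := idfun) (n := l - k.+1) Gy Gy).
  - apply/eigenvalueP; exists (v 1%N); rewrite // map_mx_id_in ?vY ?expr1 //.
  - by apply/eigenvalueP; exists u; rewrite // map_mx_id_in.
  - by rewrite exprMn cm mul1r.
have c1 : c = 1.
  by apply: (fmorph_inj f); apply: (mulIf a0); rewrite ca rmorph1 mul1r.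
by rewrite /matrix.comm_mx XY c1 scale1r.
Qed.

Hypothesis irr : absolutely_irreducible rho.

(** Let [chi] be a joint character of [A]. Some positive power of [g] fixes it, hence stabilises its
    weight space [W]. An eigenvector of that power in [W] spans a line stable under [g] by
    [stable_root], and comparing [a * g = g * a ^ g] on it shows that [g] itself fixes [chi]. So [G]
    stabilises [W], which is everything. *)
Lemma commuting_normal_scalar (A : set T) :
  (A `<=` G)%classic -> (forall a g, A a -> G g -> A (a ^ g)%g) ->
  (forall a b, A a -> A b -> comm_mx (rho a) (rho b)) ->
  forall a, A a -> is_scalar_mx (rho a).
Proof.
move=> AG AJ Acom.
have [L [f [v [v0 vA]]]] := commuting_eigenvector r_gt0
  (A := fun a : {a | A a} => rho (sval a)) (fun a b => Acom _ _ (svalP a) (svalP b)).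
have rhofP := good_rep_map rhoP f.
pose R g := map_mx f (rho g).
have RM g h : G g -> G h -> R (g * h)%g = R g *m R h by exact: (repM rhofP).
have [chi chiE] : exists chi : T -> L, forall a, A a -> v *m R a = chi a *: v.
  suff /choice[chi chiP] : forall a, exists c, A a -> v *m R a = c *: v by exists chi.
  move=> a; have [Aa|nAa] := pselect (A a); last by exists 0.
  by have /sub_rVP[c vc] := vA (exist _ a Aa); exists c.
have conjR (w : 'rV[L]_r) c a g : A a -> G g -> w *m R a = c *: w ->
    w *m R g *m R (a ^ g)%g = c *: (w *m R g).
  move=> Aa Gg wa; have Ga := AG _ Aa.
  rewrite -mulmxA -RM //; last exact: subgroupJ.
  by rewrite -conjgC RM // mulmxA wa scalemxAl.
(* The translates of [v] by powers of [g] are weight vectors for the conjugate characters, so two of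
   these characters coincide. *)
have period g : G g -> exists m, forall a, A a -> chi (a ^ (g ^+ m.+1))%g = chi a.
  move=> Gg; pose w k := v *m R (g ^+ k)%g.
  have w0 k : w k != 0.
    apply: contra_neq v0 => /(good_rep_mul_eq0 sG rhofP); apply; exact: subgroupX.
  have wA k (a : {a | A a}) : w k *m R (sval a) = chi (sval a ^ (g ^- k))%g *: w k.
    case: a => a Aa /=; have Ggk : G (g ^+ k)%g by exact: subgroupX.
    have Aak : A (a ^ (g ^- k))%g by apply: AJ => //; exact: subgroupV.
    by have := conjR v _ _ _ Aak Ggk (chiE _ Aak); rewrite conjgKV.
  have [k [l [kl chikl]]] := weights_pigeonhole (A := fun a : {a | A a} => R (sval a))
    (chi := fun k a => chi (sval a ^ (g ^- k))%g) w0 wA.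
  exists (l - k.+1)%N => a Aa.
  have Aal : A (a ^ (g ^+ l))%g by apply: AJ => //; exact: subgroupX.
  have := chikl (exist _ _ Aal) => /=; rewrite conjgK => <-.
  by rewrite -conjgM subnSK // expgnFr // ltnW.
have [m [W [frW WX XW]]] := span_basis [set w | forall a, A a -> w *m R a = chi a *: w].
have Wchi a : A a -> W *m R a = chi a *: W.
  move=> Aa; apply/row_matrixP => i; rewrite row_mul WX //.
  by apply/rowP => j; rewrite !mxE.
have vW : (v <= W)%MS by exact: XW.
have W0 : W != 0 by apply: contraNneq v0 => W0; move: vW; rewrite W0 => /submx0null ->.
have stX g : G g -> (forall a, A a -> chi (a ^ g)%g = chi a) -> stablemx W (R g).
  move=> Gg chig; apply/row_subP => i; rewrite row_mul; apply: XW => a Aa /=.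
  have Aag : A (a ^ g^-1)%g by apply: AJ => //; exact: subgroupV.
  have := conjR (row i W) _ _ _ Aag Gg (WX i _ Aag); rewrite conjgKV => ->.
  by rewrite -(chig _ Aag) conjgKV.
have inv g a : G g -> A a -> chi (a ^ g)%g = chi a.
  move=> Gg Aa; have [n chin] := period g Gg.
  have Ggn : G (g ^+ n.+1)%g by exact: subgroupX.
  have [M [f' [c [u [u0 uW uc]]]]] := extension_eigenvector W0 (stX _ Ggn chin).
  have rhoffP := good_rep_map rhofP f'.
  have /sub_rVP[d ud] : stablemx u (map_mx f' (R g)).
    by apply: (stable_root sG rhoffP Gg (n := n)); rewrite uc scalemx_sub.
  have uchi b : A b -> u *m map_mx f' (R b) = f' (chi b) *: u.
    by move=> Ab; have [z ->] := submxP uW; rewrite -mulmxA -map_mxM Wchi // map_mxZ scalemxAr.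
  have d0 : d != 0.
    apply: contra_neq u0 => d0; apply: (good_rep_mul_eq0 sG rhoffP Gg).
    by rewrite ud d0 scale0r.
  have Aag := AJ _ _ Aa Gg; have Ga := AG _ Aa.
  have e : u *m map_mx f' (R (a * g)%g) = u *m map_mx f' (R (g * a ^ g)%g).
    by rewrite conjgC.
  apply: (fmorph_inj f'); apply: (mulIf d0).
  move: e; rewrite (RM a g) // (RM g (a ^ g)%g) ?map_mxM ?mulmxA //; last exact: subgroupJ.
  rewrite ud (uchi a) // -!scalemxAl ud (uchi (a ^ g)%g) // !scalerA => /eqP.
  rewrite -subr_eq0 -scalerBl scaler_eq0 (negPf u0) orbF subr_eq0 => /eqP ->.
  by rewrite mulrC.
have [//|fullW] := irr (fun g Gg => stX g Gg (fun a Aa => inv g a Gg Aa)).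
  by move=> W0'; rewrite W0' eqxx in W0.
move=> a Aa; rewrite -(map_mx_is_scalar f); apply/is_scalar_mxP; exists (chi a).
rewrite -[LHS]mul1mx -(mulVpmx fullW) -mulmxA -/(R a) Wchi //.
by rewrite -scalemxAr mulVpmx // scalemx1.
Qed.

Lemma derived_series_commgs (N : set T) k :
  derived_series (commgs N N) k = derived_series N k.+1.
Proof. by elim: k => [//|k IHk] /=; rewrite IHk. Qed.

(** By induction on the derived length, commutators of [N] act by scalars; then [N] acts
    commutatively, hence by scalars. *)
Lemma solvable_normal_scalar (N : set T) k : is_subgroup N -> (N `<=` G)%classic ->
  (forall a g, N a -> G g -> N (a ^ g)%g) -> derived_series N k = [set 1%g]%classic ->
  forall a, N a -> is_scalar_mx (rho a).
Proof.
elim: k N => [|k IHk] N sN NG NJ /= derN.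
  move=> a; rewrite derN => ->; rewrite (rep1 rhoP); exact: scalar_mx_is_scalar.
have sub_comm : (commgs N N `<=` N)%classic.
  by apply: commgs_sub => // x y Nx Ny; exact: subgroupR.
have comm_scalar : forall a, commgs N N a -> is_scalar_mx (rho a).
  apply: IHk; last by rewrite derived_series_commgs.
  - exact: generated_subgroup.
  - by move=> a /sub_comm /NG.
  - move=> a g Ca Gg; move: a Ca; apply: generated_normalised => _ [x Nx [y Ny <-]].
    by exists (x ^ g)%g; [exact: NJ|exists (y ^ g)%g; [exact: NJ|rewrite conjRg]].
apply: commuting_normal_scalar => // a b Na Nb.
apply: scalar_commutator_commute; [exact: NG|exact: NG|].
by apply: comm_scalar; exact: commgs_mem.
Qed.

End Scalars.
End Irreducible.

(** * Virtually solvable groups *)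

Section VirtuallySolvable.
Local Open Scope classical_set_scope.
Local Open Scope group_scope.
Variable T : groupType.
Implicit Types (G H N : set T).

Lemma derived_series_subgroup N k : is_subgroup N -> is_subgroup (derived_series N k).
Proof. by case: k => [//|k] _; exact: generated_subgroup. Qed.

Lemma derived_seriesS N H k : N `<=` H -> derived_series N k `<=` derived_series H k.
Proof.
move=> NH; elim: k => [//|k IHk] /=; apply: commgs_sub; first exact: generated_subgroup.
by move=> x y /IHk Hx /IHk Hy; exact: commgs_mem.
Qed.

Lemma finite_index_exp G H : is_subgroup G -> is_subgroup H -> finite_set (cosets G H) ->
  exists n, forall x, G x -> H (x ^+ n.+1).
Proof.
(* With [m] cosets, some [x ^+ (j - i)] with [0 < j - i <= m] lies in [H], and [j - i] divides the
   factorial of [m]. *)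
move=> sG sH /finite_setP[m Gm]; exists (m`!).-1 => x Gx.
have [i [j [ij jm eij]]] : exists i j, [/\ (i < j)%N, (j <= m)%N &
    mulgs [set x ^+ i] H = mulgs [set x ^+ j] H].
  apply: contrapT => nij.
  have inj : {in `I_m.+1 &, injective (fun i => mulgs [set x ^+ i] H)}.
    move=> i j; rewrite !inE /= => im jm eij.
    have [ij|ji|//] := ltngtP i j; exfalso; apply: nij.
      by exists i, j; split=> //; rewrite -ltnS.
    by exists j, i; split=> //; rewrite -ltnS.
  have : (`I_m.+1 #<= `I_m)%card.
    rewrite -(card_le_eqr Gm) -(card_le_eql (inj_card_eq inj)).
    apply: subset_card_le => _ [i _ <-]; exists (x ^+ i) => //; exact: subgroupX.
  by rewrite card_le_II ltnn.
have Hji : H (x ^+ (j - i)).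
  have /coset_eqP := eij; move=> /(_ sH); rewrite -{1}(subnKC (ltnW ij)) expgnDr.
  by rewrite mulKg.
rewrite prednK ?fact_gt0 //.
have /dvdnP[k ->] : (j - i %| m`!)%N.
  by apply: dvdn_fact; rewrite subn_gt0 ij (leq_trans (leq_subr _ _)).
by rewrite mulnC expgnA; exact: subgroupX.
Qed.

(** The finite index is turned into an exponent: [stable_root] asks only for a fixed power of each
    [g] in the normal core [N] of [H]. *)
Lemma virtually_solvable_core G : is_subgroup G -> virtually_solvable G ->
  exists N k n, [/\ is_subgroup N, N `<=` G, forall x g, N x -> G g -> N (x ^ g),
    derived_series N k = [set 1] & forall g, G g -> N (g ^+ n.+1)].
Proof.
move=> sG [H [sH HG [k derH] finH]].
have [n Hn] := finite_index_exp sG sH finH.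
pose N := [set x | G x /\ forall g, G g -> H (x ^ g)].
have sN : is_subgroup N.
  apply/is_subgroupP; split.
    by split=> [|g _]; [exact: subgroup1|rewrite conj1g; exact: subgroup1].
  move=> x y [Gx Nx] [Gy Ny]; split; first by apply: subgroupM => //; exact: subgroupV.
  move=> g Gg; rewrite conjMg conjVg; apply: subgroupM => //; first exact: Nx.
  by apply: subgroupV => //; exact: Ny.
have NH : N `<=` H by move=> x [_ /(_ 1 (subgroup1 sG))]; rewrite conjg1.
exists N, k, n; split=> //; first by move=> x [].
- move=> x g [Gx Nx] Gg; split; first exact: subgroupJ.
  by move=> h Gh; rewrite -conjgM; apply: Nx; exact: subgroupM.
- apply/seteqP; split; first by rewrite -derH; exact: derived_seriesS.
  by move=> _ ->; apply: subgroup1; exact: derived_series_subgroup.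
- move=> g Gg; split; first exact: subgroupX.
  by move=> h Gh; rewrite conjXg; apply: Hn; exact: subgroupJ.
Qed.
End VirtuallySolvable.

(** * Simultaneous triangularization *)

Section Triangularization.
Variables (T : groupType) (G : set T).
Hypothesis sG : is_subgroup G.
Hypothesis vsG : virtually_solvable G.

(** The core acts by scalars, so every line is stable under all [g ^+ n.+1], hence under [G]; any
    nonzero vector will do. *)
Lemma irreducible_eigenvector (K : fieldType) r (rho : T -> 'M[K]_r) :
  (0 < r)%N -> good_rep G rho -> absolutely_irreducible G rho ->
  exists2 v : 'rV_r, v != 0 & forall g, G g -> stablemx v (rho g).
Proof.
move=> r0 rhoP irr.
have [N [k [n [sN NG NJ derN Nn]]]] := virtually_solvable_core sG vsG.
have sc := solvable_normal_scalar sG rhoP r0 irr sN NG NJ derN.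
exists (delta_mx 0 (Ordinal r0)).
  by apply/eqP => /rowP /(_ (Ordinal r0)) /eqP; rewrite !mxE !eqxx oner_eq0.
move=> g Gg; apply: (stable_root sG rhoP Gg (n := n)).
have /is_scalar_mxP[c ->] := sc _ (Nn _ Gg).
by rewrite mul_mx_scalar scalemx_sub.
Qed.

Lemma common_eigenvector r (K : fieldType) (rho : T -> 'M[K]_r) :
  (0 < r)%N -> good_rep G rho ->
  exists (L : fieldType) (f : {rmorphism K -> L}) (v : 'rV_r),
    v != 0 /\ forall g, G g -> stablemx v (map_mx f (rho g)).
Proof.
have [n] := ubnP r; elim: n r K rho => // n IHn r K rho; rewrite ltnS => rn r0 rhoP.
have [irr|] := pselect (absolutely_irreducible G rho).
  have [v v0 vG] := irreducible_eigenvector r0 rhoP irr.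
  exists K, idfun, v; split=> // g Gg; rewrite map_mx_id_in //; exact: vG.
move=> /existsNP[L /existsNP[f /existsNP[m /existsNP[W0 /not_implyP[st nW]]]]].
have rhofP := good_rep_map rhoP f.
have [W [frW stW]] : exists W : 'M_(\rank W0, r), row_free W /\
    forall g, G g -> stablemx W (map_mx f (rho g)).
  exists (row_base W0); split=> [|g Gg]; first exact: row_base_free.
  by rewrite stablemx_row_base; exact: st.
have rk0 : (0 < \rank W0)%N.
  by rewrite lt0n mxrank_eq0; apply/eqP => W00; apply: nW; left.
have rkr : (\rank W0 < r)%N.
  rewrite ltn_neqAle rank_leq_col andbT; apply/negP => full; apply: nW; right.
  exact: full.
have [rho' rho'W] : exists rho', forall g, G g -> rho' g *m W = W *m map_mx f (rho g).
  by exists (fun g => W *m map_mx f (rho g) *m pinvmx W) => g Gg; rewrite mulmxKpV //; exact: stW.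
have rho'P : good_rep G rho'.
  apply: (good_rep_sub sG rhofP frW rho'W); apply: (row_free_inj frW).
  by rewrite /= rho'W ?(rep1 rhofP) ?mulmx1 ?mul1mx //; exact: subgroup1.
have [M [f' [v [v0 vG]]]] := IHn _ _ _ (leq_trans rkr rn) rk0 rho'P.
exists M, (f' \o f), (v *m map_mx f' W); split.
  apply: contra_neq v0 => vW0; apply: (row_free_inj (A := map_mx f' W)).
    by rewrite row_free_map.
  by rewrite vW0 mul0mx.
move=> g Gg; rewrite [map_mx (f' \o f) _]map_mx_comp -mulmxA -map_mxM -rho'W // map_mxM mulmxA.
by apply: submxMr; exact: vG.
Qed.

Lemma eigenvalue_block (K : fieldType) r (a : 'M[K]_1) (c : 'M_(r, 1)) (d : 'M_r) x :
  eigenvalue d x -> eigenvalue (block_mx a 0 c d) x.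
Proof.
move=> /eigenvalueP[u ud u0].
have [al ->] : exists al, a = al%:M.
  by exists (a 0 0); apply/matrixP => i j; rewrite !ord1 mxE.
have [->|xa] := eqVneq x al.
  apply/eigenvalueP; exists (row_mx 1%:M 0).
    by rewrite mul_row_block !mul1mx !mul0mx !addr0 scale_row_mx scaler0 scalemx1.
  by apply/eqP => /(congr1 lsubmx); rewrite row_mxKl linear0 => /eqP; rewrite oner_eq0.
(* The first coordinate [t] must solve [t * al + u *m c = x * t]. *)
apply/eigenvalueP; exists (row_mx ((x - al)^-1 *: (u *m c)) u); last first.
  by apply: contra_neq u0 => /(congr1 rsubmx); rewrite row_mxKr linear0.
rewrite mul_row_block mulmx0 add0r ud scale_row_mx; congr (row_mx _ _).
rewrite mul_mx_scalar !scalerA -[X in _ + X]scale1r -scalerDl; congr (_ *: _).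
have xal : x - al != 0 by rewrite subr_eq0.
by apply: (mulIf xal); rewrite mulrDl mul1r !mulfVK // addrC subrK.
Qed.

Lemma eq_good_rep (K : fieldType) r (rho rho' : T -> 'M[K]_r) :
  (forall g, G g -> rho g = rho' g) -> good_rep G rho -> good_rep G rho'.
Proof.
move=> e [c0 r1 rM ru]; split=> //.
- by rewrite -e //; exact: subgroup1.
- by move=> g h Gg Gh; rewrite -!e //; [exact: rM|exact: subgroupM].
- by move=> L f g h x y n Gg Gh; rewrite -!e //; exact: ru.
Qed.

Lemma good_rep_block (K : fieldType) r (a : T -> 'M[K]_1) c (d : T -> 'M[K]_r) :
  good_rep G (fun g => block_mx (a g) 0 (c g) (d g)) -> good_rep G d.
Proof.
case=> c0 r1 rM ru; split=> //.
- by have /(congr1 drsubmx) := r1; rewrite scalar_mx_block !block_mxKdr.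
- move=> g h Gg Gh; have /(congr1 drsubmx) := rM g h Gg Gh.
  by rewrite mulmx_block !block_mxKdr mulmx0 add0r.
- move=> L f g h x y n Gg Gh ex ey.
  by apply: (ru L f g h _ _ n) => //; rewrite map_block_mx map_mx0; exact: eigenvalue_block.
Qed.

(** Put a common eigenvector first in the basis; the lower right block acts on the quotient by its
    line and is again a good representation. *)
Lemma triangularization r (K : fieldType) (rho : T -> 'M[K]_r) : good_rep G rho ->
  exists (L : fieldType) (f : {rmorphism K -> L}) (B : 'M[L]_r) (D : T -> 'M[L]_r),
    B \in unitmx /\ forall g, G g -> is_trig_mx (D g) /\ D g *m B = B *m map_mx f (rho g).
Proof.
elim: r K rho => [|r IHr] K rho rhoP.
  exists K, idfun, 1%:M, (fun g => map_mx idfun (rho g)); split; first exact: unitmx1.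
  by move=> g Gg; split; [apply/is_trig_mxP => -[]|rewrite mul1mx mulmx1].
have [L [f [v [v0 vG]]]] := common_eigenvector (ltn0Sn r) rhoP.
have rhofP := good_rep_map rhoP f.
(* As [v] has rank 1, the first row of this invertible matrix spans the line of [v]. *)
pose C : 'M_(1 + r) := row_ebase v; have uC : C \in unitmx by exact: row_ebase_unit.
have vC : v = col_ebase v *m usubmx C.
  rewrite -[LHS]mulmx_ebase rank_rV v0 -mulmxA; congr (_ *m _).
  have -> : row_ebase v = col_mx (usubmx C) (dsubmx C) by rewrite vsubmxK.
  have -> : pid_mx true = row_mx 1%:M 0 :> 'M[L]_(1, 1 + r) by rewrite pid_mx_row.
  rewrite -[RHS]mul1mx -[RHS]addr0 -[X in _ + X](mul0mx _ (dsubmx C)).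
  exact: (@mul_row_col L 1 1 r (1 + r) 1%:M 0 (usubmx C) (dsubmx C)).
have Cv : (v :=: usubmx C)%MS.
  by rewrite {1}vC; apply: eqmxMfull; rewrite row_full_unit col_ebase_unit.
pose D g := C *m map_mx f (rho g) *m invmx C.
have DC g : D g *m C = C *m map_mx f (rho g) by rewrite mulmxKV.
have D1 : D 1%g = 1%:M by rewrite /D (rep1 rhofP) mulmx1 mulmxV.
have DP : good_rep G D.
  by apply: (good_rep_sub sG rhofP (W := C)) => //; rewrite row_free_unit.
have Dblock g : G g -> D g = block_mx (ulsubmx (D g)) 0 (dlsubmx (D g)) (drsubmx (D g)).
  move=> Gg; rewrite -[LHS]submxK; congr (block_mx _ _ _ _).
  have : (usubmx (D g) <= row_mx (1%:M : 'M[L]_1) (0 : 'M_(1, r)))%MS.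
    have -> : row_mx (1%:M : 'M[L]_1) (0 : 'M_(1, r)) = usubmx C *m invmx C.
      rewrite (_ : _ *m _ = usubmx (C *m invmx C)); last by rewrite -mul_usub_mx.
      by rewrite mulmxV // scalar_mx_block block_mxEv col_mxKu.
    have -> : usubmx (D g) = usubmx C *m map_mx f (rho g) *m invmx C.
      by rewrite !mul_usub_mx.
    by apply: submxMr; rewrite -(eqmxMr _ Cv) -Cv; exact: vG.
  move=> /submxP[c cE]; rewrite /ursubmx cE mul_mx_row row_mxKr; exact: mulmx0.
have DP' : good_rep G (fun g => drsubmx (D g)).
  exact: good_rep_block (eq_good_rep Dblock DP).
have [M [f' [B' [D' [uB' D'P]]]]] := IHr _ _ DP'.
pose B0 : 'M_(1 + r) := block_mx 1%:M 0 0 B'.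
have uB0 : B0 \in unitmx by rewrite unitmxE det_ublock det1 mul1r -unitmxE.
exists M, (f' \o f), (B0 *m map_mx f' C).
exists (fun g => block_mx (map_mx f' (ulsubmx (D g))) 0 (B' *m map_mx f' (dlsubmx (D g))) (D' g)).
split.
  by rewrite unitmx_mul map_unitmx uC andbT.
move=> g Gg; have [trD' D'B'] := D'P g Gg; split.
  by rewrite (@is_trig_block_mx _ 1 r 1 r) // eqxx mx11_is_trig.
have DB0 : block_mx (map_mx f' (ulsubmx (D g))) 0 (B' *m map_mx f' (dlsubmx (D g)))
    (D' g) *m B0 = B0 *m map_mx f' (D g : 'M_(1 + r)).
  rewrite {3}(Dblock g Gg) map_block_mx map_mx0 !mulmx_block.
  by rewrite !(mul0mx, mulmx0, mul1mx, mulmx1, addr0, add0r) D'B'.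
by rewrite [map_mx (f' \o f) _]map_mx_comp -[RHS]mulmxA -map_mxM -DC map_mxM !mulmxA DB0.
Qed.

End Triangularization.

(** * Eigenvalues of p-adic matrices congruent to 1 *)

Section RootUniqueness.
Variables (p : nat) (p_pr : prime p).
Local Notation Zp := (padic p_pr).
Variables (K : fieldType) (phi : {rmorphism Zp -> K}).
Hypothesis phi_inj : injective phi.

Let int := integralOver phi.
Let q := (p ^ (p == 2).+1)%N.

Lemma phi_nat_eq0 n : (n%:R == 0 :> K) = (n == 0)%N.
Proof.
case: n => [|n]; first by rewrite mulr0n !eqxx.
rewrite -(rmorph_nat phi) (raddf_eq0 _ phi_inj); apply/negbTE.
exact: padic_nat_neq0.
Qed.

Lemma integralMn a n : int a -> int (a *+ n).
Proof. by move=> ia; rewrite -mulr_natr; apply: integral_mul => //; exact: integral_nat. Qed.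

Lemma integralX a n : int a -> int (a ^+ n).
Proof.
move=> ia; elim: n => [|n IHn]; first by rewrite expr0; exact: integral1.
by rewrite exprS; exact: integral_mul.
Qed.

Lemma integral_sum (I : Type) (r : seq I) (F : I -> K) :
  (forall i, int (F i)) -> int (\sum_(i <- r) F i).
Proof.
move=> iF; apply: big_ind => [|x y ix iy|i _]; [exact: integral0|exact: integral_add|exact: iF].
Qed.

(** Multiplying a monic equation of degree [m] for [w] by [p ^ m] and using [p * w = - n] gives
    [(- n) ^ m + p * z = 0] with [z] a p-adic integer. *)
Lemma integral_nonunit n w : int w -> n%:R + p%:R * w = 0 -> (p %| n)%N.
Proof.
move=> [h monh rooth] nw.
have pw : p%:R * w = - n%:R by apply/eqP; rewrite -addr_eq0 addrC nw.
have szh : size h = (size h).-1.+1 by rewrite prednK // size_poly_gt0 monic_neq0.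
set m := (size h).-1 in szh.
pose z : Zp := \sum_(i < m) h`_i * (- n%:R) ^+ i * p%:R ^+ (m - i.+1).
have : phi ((- n%:R) ^+ m + p%:R * z) = 0.
  have /eqP := rooth; rewrite horner_coef size_map_inj_poly ?rmorph0 // szh big_ord_recr /=.
  rewrite !coef_map /= (_ : h`_m = 1); last by have /monicP := monh.
  rewrite rmorph1 mul1r => /(congr1 (fun y => p%:R ^+ m * y)); rewrite mulr0 => <-.
  rewrite rmorphD rmorphXn rmorphN rmorph_nat -pw exprMn mulrDr addrC; congr (_ + _).
  rewrite rmorphM rmorph_nat rmorph_sum !mulr_sumr; apply: eq_bigr => i _.
  rewrite !rmorphM !rmorphXn rmorphN !rmorph_nat -pw exprMn coef_map /=.
  have -> : (p%:R : K) ^+ m = p%:R * p%:R ^+ (m - i.+1) * p%:R ^+ i.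
    by rewrite -exprS -exprD subnSK // subnK // ltnW.
  ring.
rewrite -(rmorph0 phi) => /phi_inj.
move=> /eqP; rewrite addr_eq0 exprNn => /eqP nz.
have : n%:R ^+ m = p%:R * (- (-1) ^+ m * z) :> Zp.
  rewrite mulrCA mulNr -mulrN -nz mulrA -exprMn mulrNN mulr1 expr1n mul1r //.
move=> /(congr1 (fun a : Zp => residue a 1)).
rewrite residueM -natrX !residue_nat expn1 modnn mul0n mod0n => /eqP.
by rewrite -/(dvdn _ _) Euclid_dvdX // => /andP[].
Qed.

Lemma expr1D_expand (x : K) n : int x -> exists2 w, int w & (1 + x) ^+ n = 1 + x *+ n + x ^+ 2 * w.
Proof.
move=> ix; elim: n => [|n [w iw IHn]].
  by exists 0; [exact: integral0|rewrite expr0 mulr0n mulr0 !addr0].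
exists (n%:R + w + x * w).
  apply: integral_add; last exact: integral_mul.
  by apply: integral_add => //; exact: integral_nat.
by rewrite exprSr IHn -[x *+ n]mulr_natr -[x *+ n.+1]mulr_natr -natr1; ring.
Qed.

(** For [a] and [b] distinct, the sum of the [a ^ (l - 1 - i) * b ^ i] vanishes; modulo [q ^ 2] it
    is [l + q * (x + y) * 'C(l, 2)]. If [l] is not p, this forces p to divide [l]. If [l = p], both
    [q * 'C(p, 2)] and [q ^ 2] are multiples of [p ^ 2] (for p = 2 because q = 4), and dividing by p
    makes p divide 1. *)
Lemma prime_root_unique l (x y : K) : prime l -> int x -> int y ->
  (1 + q%:R * x) ^+ l = (1 + q%:R * y) ^+ l -> x = y.
Proof.
move=> l_pr ix iy exy.
have q0 : q%:R != 0 :> K by rewrite phi_nat_eq0 -lt0n expn_gt0 prime_gt0.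
apply/eqP; apply: contraT => nxy.
set a := 1 + q%:R * x in exy; set b := 1 + q%:R * y in exy.
have iqx : int (q%:R * x) by apply: integral_mul => //; exact: integral_nat.
have iqy : int (q%:R * y) by apply: integral_mul => //; exact: integral_nat.
have ab0 : a - b != 0.
  by rewrite opprD addrACA subrr add0r -mulrBr mulf_neq0 // subr_eq0.
have sum0 : \sum_(i < l) a ^+ (l.-1 - i) * b ^+ i = 0.
  by apply: (mulfI ab0); rewrite mulr0 -subrXX exy subrr.
have termE i j : exists2 w, int w &
    a ^+ i * b ^+ j = 1 + q%:R * (x *+ i + y *+ j) + (q ^ 2)%:R * w.
  have [u iu au] := expr1D_expand i iqx; have [v iv bv] := expr1D_expand j iqy.
  rewrite natrX; set Q := q%:R in au bv *.
  exists (x *+ i * (y *+ j) + x ^+ 2 * u * b ^+ j + y ^+ 2 * v * (1 + Q * (x *+ i))).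
    have ib : int (b ^+ j).
      by apply: integralX; apply: integral_add => //; exact: integral1.
    have iQ : int Q by exact: integral_nat.
    have ixi : int (x *+ i) by exact: integralMn.
    have iyj : int (y *+ j) by exact: integralMn.
    have i1 : int 1 by exact: integral1.
    by do ?[apply: integral_add => // | apply: integral_mul => // | apply: integralX => //].
  rewrite au bv -!mulrnAr; move: (x *+ i) (y *+ j) => X Y; ring.
have [w [iw sumE]] : exists w, int w /\ \sum_(i < l) a ^+ (l.-1 - i) * b ^+ i =
    l%:R + q%:R * ((x + y) *+ 'C(l, 2)) + (q ^ 2)%:R * w.
  have /choice[w wP] : forall i : 'I_l, exists w, int w /\ a ^+ (l.-1 - i) * b ^+ i =
      1 + q%:R * (x *+ (l.-1 - i) + y *+ i) + (q ^ 2)%:R * w.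
    by move=> i; have [w iw e] := termE (l.-1 - i)%N i; exists w.
  exists (\sum_i w i); split; first by apply: integral_sum => i; case: (wP i).
  rewrite (eq_bigr _ (fun i _ => (wP i).2)) !big_split /= sumr_const card_ord.
  congr (_ + _ + _); last by rewrite mulr_sumr.
  rewrite -mulr_sumr big_split /= !sumrMnr mulrnDl; congr (_ * (_ *+ _ + _ *+ _)).
    rewrite -bin2_sum big_mkord (reindex_inj rev_ord_inj) /=; apply: eq_bigr => i _.
    have := ltn_ord i; lia.
  by rewrite -bin2_sum big_mkord.
have [lp|lp] := eqVneq l p.
  have [m qC] : exists m, (q * 'C(l, 2) = p * p * m)%N.
    rewrite lp /q; have [->|p2] := eqVneq p 2%N; first by exists 1%N.
    have /dvdnP[m ->] : (p %| 'C(p, 2))%N.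
      by rewrite prime_dvd_bin //= ltn_neqAle eq_sym p2 prime_gt1.
    by exists m; rewrite expn1; ring.
  have [m' q2] : exists m', (q ^ 2 = p * p * m')%N.
    exists ((p ^ (p == 2)) ^ 2)%N; by rewrite /q [(p ^ _.+1)%N]expnS expnMn -mulnn.
  have i1 : int ((x + y) *+ m + w *+ m').
    by apply: integral_add; apply: integralMn => //; exact: integral_add.
  have := @integral_nonunit 1 _ i1; rewrite dvdn1 gtn_eqF ?prime_gt1 //.
  suff -> : 1%:R + p%:R * ((x + y) *+ m + w *+ m') = 0 by move=> /(_ erefl).
  have p0 : p%:R != 0 :> K by rewrite phi_nat_eq0 -lt0n prime_gt0.
  apply: (mulfI p0); rewrite mulr0 -sum0 sumE lp.
  rewrite -[_ *+ 'C(p, 2)]mulr_natl mulrA -natrM -lp qC q2 !natrM.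
  by rewrite -[_ *+ m]mulr_natl -[_ *+ m']mulr_natl lp; ring.
have : (p %| l)%N.
  apply: (@integral_nonunit l (((x + y) *+ 'C(l, 2) + q%:R * w) *+ (p ^ (p == 2)))).
    apply: integralMn; apply: integral_add; first by apply: integralMn; exact: integral_add.
    by apply: integral_mul => //; exact: integral_nat.
  rewrite -sum0 sumE -[_ *+ (p ^ _)]mulr_natl mulrA -natrM -expnS -/q.
  by rewrite mulrDr addrA mulrA -natrM mulnn.
by rewrite dvdn_prime2 // eq_sym (negPf lp).
Qed.

(** Write [n.+1 = k * l] with [l] prime: [k]-th powers keep the form [1 + q * x'], so the prime case
    lowers the exponent to [k]. *)
Lemma root_unique n (x y : K) : int x -> int y ->
  (1 + q%:R * x) ^+ n.+1 = (1 + q%:R * y) ^+ n.+1 -> x = y.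
Proof.
have [m] := ubnP n; elim: m n x y => // m IHm n x y; rewrite ltnS => nm ix iy.
have [n1|n1] := leqP n.+1 1.
  have q0 : q%:R != 0 :> K by rewrite phi_nat_eq0 -lt0n expn_gt0 prime_gt0.
  have -> : n = 0%N by case: n n1 {nm}.
  by rewrite !expr1 => /addrI /(mulfI q0).
have l_pr := pdiv_prime n1; have /dvdnP[k nk] := pdiv_dvd n.+1.
have powE z : int z -> exists2 z', int z' &
    (1 + q%:R * z) ^+ k = 1 + q%:R * z'.
  move=> iz; have iqz : int (q%:R * z) by apply: integral_mul => //; exact: integral_nat.
  have [w iw ->] := expr1D_expand k iqz; exists (z *+ k + z * (q%:R * z) * w).
    apply: integral_add; first exact: integralMn.
    by do 2!apply: integral_mul => //.
  by rewrite -[z *+ k]mulr_natl -[_ *+ k]mulr_natl; ring.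
have [x' ix' xk] := powE x ix; have [y' iy' yk] := powE y iy.
rewrite nk !exprM xk yk => /(prime_root_unique l_pr ix' iy') xy'.
have k0 : (0 < k)%N by case: k nk {xk yk powE}.
apply: (IHm k.-1) => //; last by rewrite prednK // xk yk xy'.
have : (k < n.+1)%N by rewrite nk ltn_Pmulr // prime_gt1.
by rewrite ltnS => kn; rewrite prednK // (leq_trans kn).
Qed.

(** [(a - 1) / q] is an eigenvalue of [X], whose characteristic polynomial is monic over Z_p. *)
Lemma eigenvalue_congruent r (A X : 'M[Zp]_r) a : A = 1%:M + q%:R *: X ->
  eigenvalue (map_mx phi A) a -> exists2 x, int x & a = 1 + q%:R * x.
Proof.
move=> AE /eigenvalueP[v va v0].
have q0 : q%:R != 0 :> K by rewrite phi_nat_eq0 -lt0n expn_gt0 prime_gt0.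
exists ((a - 1) / q%:R); last by rewrite mulrCA divff // mulr1 addrC subrK.
have : eigenvalue (map_mx phi X) ((a - 1) / q%:R).
  apply/eigenvalueP; exists v => //.
  move: va; rewrite AE map_mxD map_mx1 map_mxZ mulmxDr mulmx1 -scalemxAr rmorph_nat => va.
  rewrite mulrC -scalerA scalerBl scale1r -va addrAC subrr add0r scalerA mulVf //.
  by rewrite scale1r.
rewrite eigenvalue_root_char -map_char_poly => rootX.
by exists (char_poly X) => //; exact: char_poly_monic.
Qed.

End RootUniqueness.

(** * The Fitting subgroup *)

Lemma fraction_num (R : idomainType) (x : {fraction R}) :
  exists a b : R, b != 0 /\ tofrac b * x = tofrac a.
Proof.
elim/quotW: x => x; exists (frac x).1, (frac x).2; split; first exact: denom_ratioP.
unlock tofrac; rewrite -[LHS]FracField.pi_mul.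
apply/eqmodP; rewrite /= FracField.equivfE /FracField.mulf.
rewrite !numden_Ratio ?(oner_eq0, mul1r, mulr1, denom_ratioP) //.
Qed.

Lemma fraction_denominator (R : idomainType) m n (M : 'M[{fraction R}]_(m, n)) :
  exists2 c : R, c != 0 & exists M', map_mx (@tofrac R) M' = tofrac c *: M.
Proof.
have /choice[b bP] : forall ij : 'I_m * 'I_n, exists b : R,
    b != 0 /\ exists a, tofrac b * M ij.1 ij.2 = tofrac a.
  move=> ij; have [a [b [b0 e]]] := fraction_num (M ij.1 ij.2).
  by exists b; split=> //; exists a.
exists (\prod_ij b ij); first by apply/prodf_neq0 => ij _; case: (bP ij).
have /choice[N NP] : forall ij : 'I_m * 'I_n, exists a : R,
    tofrac (\prod_ij b ij) * M ij.1 ij.2 = tofrac a.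
  move=> ij; have [_ [a ae]] := bP ij; exists (\prod_(kl | kl != ij) b kl * a).
  rewrite (bigD1 ij) //= [in LHS]rmorphM [in RHS]rmorphM /= -ae.
  by rewrite -mulrA mulrCA.
by exists (\matrix_(i, j) N (i, j)); apply/matrixP => i j; rewrite !mxE -(NP (i, j)).
Qed.

Section StrictlyTriangular.
Variables (K : fieldType) (r : nat).
Implicit Types A B : 'M[K]_r.

(** Lower triangular for k = 0, strictly so for k = 1; widths add under products, which bounds the
    nilpotency class. *)
Definition lower_band k A := forall s t : 'I_r, (s < t + k)%N -> A s t = 0.

Lemma lower_bandM k l A B : lower_band k A -> lower_band l B -> lower_band (k + l) (A *m B).
Proof.
move=> Ak Bl s t st; rewrite mxE big1 // => u _.
have [su|us] := ltnP s (u + k); first by rewrite Ak // mul0r.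
rewrite Bl ?mulr0 //; move: (leq_ltn_trans us st).
by rewrite addnCA addnC ltn_add2l.
Qed.

Lemma lower_bandB k A B : lower_band k A -> lower_band k B -> lower_band k (A - B).
Proof. by move=> Ak Bk s t st; rewrite !mxE Ak // Bk // subr0. Qed.

Lemma lower_band_full A : lower_band r A -> A = 0.
Proof.
move=> Ar; apply/matrixP => s t; rewrite Ar ?mxE //.
by rewrite (leq_trans (ltn_ord s)) // leq_addl.
Qed.

Lemma trig_mul_diag A B i : is_trig_mx A -> is_trig_mx B -> (A *m B) i i = A i i * B i i.
Proof.
move=> /is_trig_mxP tA /is_trig_mxP tB; rewrite mxE (bigD1 i) //= big1 ?addr0 // => j ji.
have [ij|ij|/val_inj e] := ltngtP i j; first by rewrite tA ?mul0r.
  by rewrite tB ?mulr0.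
by rewrite e eqxx in ji.
Qed.

Lemma trig_eigenvalue A i : is_trig_mx A -> eigenvalue A (A i i).
Proof.
move=> tA; rewrite eigenvalue_root_char char_poly_trig // (bigD1 i) //=.
by rewrite rootM root_XsubC eqxx.
Qed.

End StrictlyTriangular.

Section CosetProducts.
Local Open Scope classical_set_scope.
Local Open Scope group_scope.
Variables (T : groupType) (G N : set T).
Hypothesis sG : is_subgroup G.
Hypothesis nN : is_normal_in N G.

Let sN : is_subgroup N. Proof. by case: nN. Qed.

Lemma coset_mulg x y : G x -> G y ->
  mulgs (mulgs [set x] N) (mulgs [set y] N) = mulgs [set x * y] N.
Proof.
case: nN => _ NG NJ Gx Gy; apply/seteqP; split=> z.
  move=> [a]; rewrite coset_memE => Na [b]; rewrite coset_memE => Nb <-.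
  rewrite coset_memE (_ : _ * (a * b) = (x^-1 * a) ^ y * (y^-1 * b)).
    by apply: subgroupM => //; exact: NJ.
  by rewrite conjgE !gnorm.
rewrite coset_memE => Nz; exists x; first by rewrite coset_memE mulVg; exact: subgroup1.
exists (x^-1 * z); last by rewrite mulVKg.
by rewrite coset_memE mulgA -invgM.
Qed.

Lemma quotient_abelianP : (forall x y, G x -> G y -> N [~ x, y]) -> quotient_abelian G N.
Proof.
move=> abN _ _ [x Gx <-] [y Gy <-]; rewrite !coset_mulg //.
by apply/(coset_eqP _ _ sN); rewrite invgM -mulgA -conjgE -commgEl; exact: abN.
Qed.

Lemma quotient_torsion_freeP : (forall x n, G x -> N (x ^+ n.+1) -> N x) ->
  quotient_torsion_free G N.
Proof.
move=> tfN _ [//|n] [x Gx <-] _ itN.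
have iterE k : iter k (mulgs (mulgs [set x] N)) N = mulgs [set x ^+ k] N.
  elim: k => [|k IHk].
    by apply/seteqP; split=> z; rewrite expg0 coset_memE invg1 mul1g.
  by rewrite iterS IHk coset_mulg ?expgS //; exact: subgroupX.
have N1 : N = mulgs [set 1] N := iterE 0%N.
move: itN; rewrite iterE => e.
have /tfN : N (x ^+ n.+1) by rewrite -e coset_memE mulVg; exact: subgroup1.
move=> /(_ Gx) Nx; rewrite [RHS]N1; apply/(coset_eqP _ _ sN).
by rewrite mulg1; exact: subgroupV.
Qed.

End CosetProducts.

Section FittingSubgroup.
Variables (p : nat) (p_pr : prime p) (T : groupType) (d : nat).
Local Notation Zp := (padic p_pr).
Local Notation Qp := {fraction Zp}.
Variables (L : T -> 'rV[Zp]_d) (A : T -> 'M[Zp]_d).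
Hypothesis logP : is_padic_log L A.
Variable G : set T.
Hypothesis sG : is_subgroup G.
Hypothesis vsG : virtually_solvable G.

Let tf : {rmorphism Zp -> Qp} := @tofrac Zp.
Let tf_inj : injective tf.
Proof. by move=> x y /eqP; rewrite tofrac_eq => /eqP. Qed.

Lemma tf_mx_eq0 m n (M : 'M[Zp]_(m, n)) : map_mx tf M = 0 -> M = 0.
Proof.
move=> /matrixP M0; apply/matrixP => i j; apply: tf_inj.
by have := M0 i j; rewrite !mxE rmorph0.
Qed.

Definition qlog x : 'rV[Qp]_d := map_mx tf (L x).
Definition qad g : 'M[Qp]_d := map_mx tf (A g).

Lemma qlog_conj x g : qlog (x ^ g)%g = qlog x *m qad g.
Proof. by rewrite /qlog (padic_log_conj logP) map_mxM. Qed.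

Lemma qlog_inj : injective qlog.
Proof.
move=> x y xy; apply: (padic_log_inj logP); apply/rowP => i.
by apply: tf_inj; move/rowP: xy => /(_ i); rewrite !mxE.
Qed.

Lemma qad_good_rep : good_rep G qad.
Proof.
split.
- by move=> n; rewrite (phi_nat_eq0 tf_inj).
- by rewrite /qad (padic_log_ad1 logP) map_mx1.
- by move=> g h _ _; rewrite /qad (padic_log_adM logP) map_mxM.
move=> F f g h a b n _ _; rewrite -!map_mx_comp.
have ftf_inj : injective (f \o tf) by move=> x y /fmorph_inj /tf_inj.
have [[X AX] [Y AY]] := (padic_log_ad_mod logP g, padic_log_ad_mod logP h).
move=> /(eigenvalue_congruent ftf_inj AX)[x ix ->].
move=> /(eigenvalue_congruent ftf_inj AY)[y iy ->].
by move=> /(root_unique ftf_inj ix iy) ->.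
Qed.

(* [L (y * m) - L y] is a limit of elements [p ^ -n *: L w] with [w] in [N], and
   a subspace is closed. *)
Lemma qlog_diff (N : set T) m (V : 'M_(m, d)) y z : is_subgroup N ->
  (forall x, N x -> N (x ^ y^-1)%g) -> (forall x, N x -> (qlog x <= V)%MS) -> N z ->
  (qlog (y * z)%g - qlog y <= V)%MS.
Proof.
move=> sN NJ NV Nz; rewrite submxE.
(* Clearing denominators in the cokernel of [V] turns membership in [V] into linear equations over
   Z_p, where divisibility makes sense. *)
have [c c0 [M' M'E]] := @fraction_denominator Zp _ _ (cokermx V).
have kerN x : N x -> L x *m M' = 0.
  move=> Nx; have : qlog x *m cokermx V = 0 by apply/eqP; rewrite -submxE NV.
  move=> /(congr1 (fun B => tf c *: B)); rewrite scaler0 scalemxAr -M'E -map_mxM => e.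
  exact: tf_mx_eq0.
have Nk k : N ((y * z) ^+ k * (y ^+ k)^-1)%g.
  elim: k => [|k IHk]; first by rewrite !expg0 divgg; exact: subgroup1.
  rewrite (_ : (_ / _)%g = ((z * ((y * z) ^+ k * (y ^+ k)^-1)) ^ y^-1)%g).
    by apply: NJ; exact: subgroupM.
  by rewrite !expgS invgM conjgE invgK !mulgA.
(* By [padic_log_diff] these entries are divisible by [p ^ n] for every [n]. *)
have v0 : (L (y * z)%g - L y) *m M' = 0.
  apply/matrixP => i j; rewrite [RHS]mxE; apply: padicP => n.
  have [s] := padic_log_diff logP (y * z)%g y n.
  move=> /(congr1 (fun B => B *m M')); rewrite mulmxDl kerN ?add0r; last exact: Nk.
  rewrite -!scalemxAl expnD natrM -scalerA => e.
  have pn0 : (p ^ n)%:R != 0 :> Zp by apply: padic_nat_neq0; rewrite expn_gt0 prime_gt0.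
  have {}e : (L (y * z)%g - L y) *m M' = (p ^ n)%:R *: (s *m M').
    apply/matrixP => k l; move/matrixP: e => /(_ k l).
    by rewrite [LHS]mxE [RHS]mxE => /(mulfI pn0).
  by rewrite e [X in residue X]mxE residueM residue_nat modnn mul0n mod0n residue0.
have : map_mx tf (L (y * z)%g - L y) *m (tf c *: cokermx V) = 0.
  by rewrite -M'E -map_mxM v0 map_mx0.
rewrite -scalemxAr map_mxB => /eqP; rewrite scaler_eq0.
by rewrite -(rmorph0 tf) (inj_eq tf_inj) (negPf c0).
Qed.

Lemma lower_central_series_normal N j : is_normal_in N G ->
  is_normal_in (lower_central_series N j) G.
Proof.
move=> nN; elim: j => [//|j [sNj NjG NjJ]] /=; case: nN => sN NG NJ; split.
- exact: generated_subgroup.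
- by apply: commgs_sub => // x y Nx Ny; apply: subgroupR; [|exact: NjG|exact: NG].
- move=> x g Cx Gg; move: x Cx; apply: generated_normalised => _ [x Nx [y Ny <-]].
  by exists (x ^ g)%g; [exact: NjJ|exists (y ^ g)%g; [exact: NJ|rewrite conjRg]].
Qed.

(* [V j] spans the logarithms of the [j]-th term of the lower central series. *)
Lemma nilpotent_flag N : is_normal_in N G -> is_nilpotent N ->
  exists c (m : nat -> nat) (V : forall j, 'M[Qp]_(m j, d)),
    [/\ V c = 0,
        forall y x, G y -> N x -> (qlog y *m (qad x - 1%:M) <= V 0%N)%MS &
        forall j x, N x -> (V j *m (qad x - 1%:M) <= V j.+1)%MS].
Proof.
move=> nN [c Nc]; have [sN NG NJ] := nN.
have nNj j := lower_central_series_normal j nN.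
have /choice[mV mVP] : forall j, exists mV : {m & 'M[Qp]_(m, d)},
    (forall i, exists2 y, lower_central_series N j y & row i (projT2 mV) = qlog y) /\
    forall y, lower_central_series N j y -> (qlog y <= projT2 mV)%MS.
  move=> j; have [m [W [_ WX XW]]] :=
    span_basis [set v | exists2 y, lower_central_series N j y & v = qlog y].
  by exists (existT _ m W); split=> [i|y Ny]; [exact: WX|apply: XW; exists y].
have step j y x : lower_central_series N j [~ y, x]%g -> G y ->
    (qlog y *m (qad x - 1%:M) <= projT2 (mV j))%MS.
  move=> Nyx Gy; have [sNj _ NjJ] := nNj j.
  rewrite mulmxBr mulmx1 -qlog_conj.
  (* [qlog y *m (qad x - 1)] is [qlog (y ^ x) - qlog y], so the commutator [y, x] controls it. *)
  have -> : (y ^ x)%g = (y * [~ y, x])%g by rewrite commgEl mulVKg.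
  apply: (qlog_diff (N := lower_central_series N j)) => //; last exact: (mVP j).2.
  by move=> z Nz; apply: NjJ => //; exact: subgroupV.
exists c, (fun j => projT1 (mV j)), (fun j => projT2 (mV j)); split.
- apply/row_matrixP => i; have [y Ny ->] := (mVP c).1 i.
  have -> : y = 1%g by have := Ny; rewrite Nc.
  by rewrite row0 /qlog (padic_log1 logP) map_mx0.
- move=> y x Gy Nx; apply: step => //=; rewrite commgEr; apply: subgroupM => //.
  by apply: NJ => //; exact: subgroupV.
- move=> j x Nx; apply/row_subP => i; rewrite row_mul.
  have [y Ny ->] := (mVP j).1 i; apply: step; first exact: commgs_mem.
  by case: (nNj j) => _ NjG _; exact: NjG.
Qed.

(** [D g] is the action of [g] on the span of the logarithms of [G], in the triangularizing basis
    [B *m map_mx f W]. The rows of [W] are themselves logarithms, so [nilpotent_flag] applies to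
    them. *)
Lemma fitting_flag : exists (F : fieldType) (f : {rmorphism Qp -> F}) r (W : 'M[Qp]_(r, d))
    (D : T -> 'M[F]_r) (B : 'M[F]_(r, r)),
  [/\ forall x, G x -> (qlog x <= W)%MS, forall i, exists2 y, G y & row i W = qlog y,
      [/\ good_rep G D, B \in unitmx & row_free (B *m map_mx f W)],
      forall g, G g -> is_trig_mx (D g) &
      forall g, G g -> D g *m (B *m map_mx f W) = B *m map_mx f W *m map_mx f (qad g)].
Proof.
have [r [W [frW WX XW]]] := span_basis [set v | exists2 y, G y & v = qlog y].
have stW g : G g -> stablemx W (qad g).
  move=> Gg; apply/row_subP => i; rewrite row_mul; have [y Gy ->] := WX i.
  by rewrite -qlog_conj; apply: XW; exists (y ^ g)%g => //; exact: subgroupJ.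
have [rho rhoW] : exists rho, forall g, G g -> rho g *m W = W *m qad g.
  by exists (fun g => W *m qad g *m pinvmx W) => g Gg; rewrite mulmxKpV //; exact: stW.
have rho1 : rho 1%g = 1%:M.
  apply: (row_free_inj frW); rewrite /= rhoW ?mul1mx; last exact: subgroup1.
  by rewrite (rep1 qad_good_rep) mulmx1.
have rhoP := good_rep_sub sG qad_good_rep frW rhoW rho1.
have [F [f [B [D [uB DP]]]]] := triangularization sG vsG rhoP.
have frB : row_free B by rewrite row_free_unit.
have rhofP := good_rep_map rhoP f.
exists F, f, r, W, D, B; split.
- by move=> x Gx; apply: XW; exists x.
- exact: WX.
- split=> //; last by rewrite /row_free mxrankMfree ?row_free_map // (eqP frB).
  apply: (good_rep_sub sG rhofP frB (fun g Gg => (DP g Gg).2)).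
  apply: (row_free_inj frB); rewrite /= (DP _ (subgroup1 sG)).2 mul1mx.
  by rewrite (rep1 rhofP) mulmx1.
- by move=> g /DP[].
- by move=> g Gg; rewrite mulmxA (DP g Gg).2 -!mulmxA -!map_mxM rhoW.
Qed.

Lemma Fitting_structure : [/\ is_nilpotent (Fitting G),
  quotient_abelian G (Fitting G) & quotient_torsion_free G (Fitting G)].
Proof.
have [K [f [r [W [D [B [GW WG [DP uB frV] trD DV]]]]]]] := fitting_flag.
set V := B *m map_mx f W in frV DV.
have DM : forall g h, G g -> G h -> D (g * h)%g = D g *m D h := repM DP.
pose F : set T := [set g | G g /\ forall i, D g i i = 1]%classic.
have diagM g h i : G g -> G h -> D (g * h)%g i i = D g i i * D h i i.
  by move=> Gg Gh; rewrite DM // trig_mul_diag //; exact: trD.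
have diag1 i : D 1%g i i = 1 by rewrite (rep1 DP) mxE eqxx.
have diagV g i : G g -> D g^-1%g i i = (D g i i)^-1.
  move=> Gg; have GVg := subgroupV sG Gg.
  have e : D g^-1%g i i * D g i i = 1 by rewrite -diagM // mulVg diag1.
  by rewrite -[RHS]mul1r -e mulfK //; apply: contra_eq_neq e => ->; rewrite mulr0 eq_sym oner_eq0.
have diag_neq0 g i : G g -> D g i i != 0.
  move=> Gg; have := diagM g g^-1%g i Gg (subgroupV sG Gg).
  by rewrite mulgV diag1 => e; apply: contra_eq_neq e => ->; rewrite mul0r oner_eq0.
have diagR g h i : G g -> G h -> D [~ g, h]%g i i = 1.
  move=> Gg Gh; have [GVg GVh] := (subgroupV sG Gg, subgroupV sG Gh).
  have Ggh := subgroupM sG Gg Gh; have GVhgh := subgroupM sG GVh Ggh.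
  rewrite commgEl conjgE !diagM // !diagV // [X in _ * X]mulrCA mulVf ?diag_neq0 //.
  by rewrite mulr1 mulVf ?diag_neq0.
have sF : is_subgroup F.
  apply/is_subgroupP; split; first by split=> [|i]; [exact: subgroup1|exact: diag1].
  move=> x y [Gx Dx] [Gy Dy]; split=> [|i]; first by apply: subgroupM => //; exact: subgroupV.
  by rewrite diagM ?diagV ?Dx ?Dy ?invr1 ?mulr1 //; exact: subgroupV.
have nF : is_normal_in F G.
  split=> //; first by move=> x [].
  move=> x g [Gx Dx] Gg; split=> [|i]; first exact: subgroupJ.
  have -> : (x ^ g)%g = (x * [~ x, g])%g by rewrite commgEl mulVKg.
  by rewrite diagM ?Dx ?diagR ?mulr1 //; exact: subgroupR.
have band0 g : G g -> lower_band 0 (D g).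
  by move=> Gg s t; rewrite addn0 => st; move/is_trig_mxP: (trD g Gg); exact.
(* The filtration of the unitriangular group by distance from the diagonal. *)
pose band j : set T := [set g | G g /\ lower_band j.+1 (D g - 1%:M)]%classic.
have sband j : is_subgroup (band j).
  apply/is_subgroupP; split.
    by split; [exact: subgroup1|move=> s t _; rewrite (rep1 DP) subrr mxE].
  move=> x y [Gx Bx] [Gy By]; have GVy := subgroupV sG Gy; split; first exact: subgroupM.
  have -> : D (x / y)%g - 1%:M = ((D x - 1%:M) - (D y - 1%:M)) *m D y^-1%g.
    by rewrite opprB addrA subrK mulmxBl -!DM // mulgV (rep1 DP).
  by rewrite -[j.+1]addn0; apply: lower_bandM; [exact: lower_bandB|exact: band0].
have bandR j x y : band j x -> band 0%N y -> band j.+1 [~ x, y]%g.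
  move=> [Gx Bx] [Gy By]; have [GVx GVy] := (subgroupV sG Gx, subgroupV sG Gy).
  split; first exact: subgroupR.
  (* With X = D x - 1 and Y = D y - 1, the matrices D x and D y have commutator X Y - Y X. *)
  have -> : D [~ x, y]%g - 1%:M = D (x^-1 * y^-1)%g *m
      ((D x - 1%:M) *m (D y - 1%:M) - (D y - 1%:M) *m (D x - 1%:M)).
    have -> : [~ x, y]%g = (x^-1 * y^-1 * (x * y))%g by rewrite commgEl conjgE !mulgA.
    have e1 : (1%:M : 'M[K]_r) = D (x^-1 * y^-1)%g *m D (y * x)%g.
      rewrite -DM; [|exact: subgroupM|exact: subgroupM].
      by rewrite -invgM mulVg (rep1 DP).
    rewrite [X in _ - X = _]e1.
    have Gw := subgroupM sG GVx GVy; rewrite (DM _ _ Gw (subgroupM sG Gx Gy)) -mulmxBr.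
    congr (_ *m _).
    rewrite !DM // !mulmxBl !mulmxBr !mulmx1 !mul1mx.
    move: (D x *m D y) (D y *m D x) => M N; apply/matrixP => s t.
    by rewrite ![in LHS]mxE ![in RHS]mxE; ring.
  rewrite -[j.+2]add0n; apply: lower_bandM; first by apply: band0; exact: subgroupM.
  apply: lower_bandB; first by rewrite -addn1 -[j.+1]addn0 -addnA; exact: lower_bandM.
  by rewrite -add1n; exact: lower_bandM.
have F_band : (F `<=` band 0%N)%classic.
  move=> x [Gx Dx]; split=> // s t; rewrite addn1 ltnS leq_eqVlt => /predU1P[/val_inj->|st].
    by rewrite !mxE Dx eqxx subrr.
  by rewrite !mxE (is_trig_mxP (trD x Gx)) // -val_eqE ltn_eqF // subr0.
have nilF : is_nilpotent F.
  have lcs j : (lower_central_series F j `<=` band j)%classic.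
    elim: j => [//|j IHj] /=; apply: commgs_sub => // x y /IHj Bx /F_band By.
    exact: bandR.
  (* After [r] steps [D x = 1]: [x] fixes the logarithms of [G], so it centralises [G] without
     having to be 1. One more commutator gives 1. *)
  exists r.+1; apply/seteqP; split=> [|_ ->]; last by apply: subgroup1; exact: generated_subgroup.
  apply: commgs_sub; first by apply/is_subgroupP; split=> // x y -> ->; rewrite /= divgg.
  move=> x y /lcs[Gx Bx] [Gy _]; apply/eqP/commgP.
  have Dx : D x = 1%:M.
    apply/eqP; rewrite -subr_eq0; apply/eqP; apply: lower_band_full => s t st.
    by apply: Bx; rewrite (leq_trans st) // addnS leqW.
  have Wx : map_mx f W *m map_mx f (qad x) = map_mx f W.
    by rewrite -[LHS](mulKmx uB) [B *m _]mulmxA -/V -DV // Dx mul1mx mulKmx.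
  have [z yz] := submxP (GW y Gy).
  apply/commute_sym/commgP/conjg_fixP; apply: qlog_inj.
  apply: (@map_mx_inj _ _ f); by rewrite qlog_conj yz !map_mxM -mulmxA Wx.
have subF N : is_normal_in N G -> is_nilpotent N -> (N `<=` F)%classic.
  move=> nN nilN; have [c [m [U [Uc WU0 UU]]]] := nilpotent_flag nN nilN.
  have [sN NG NJ] := nN.
  move=> x Nx; have Gx := NG _ Nx; split=> // i.
  have /eigenvalueP[v va v0] := trig_eigenvalue i (trD x Gx).
  set a := D x i i in va *.
  pose u := v *m V.
  have u0 : u != 0 by apply: contra_neq v0 => u0; apply: (row_free_inj frV); rewrite [LHS]u0 mul0mx.
  have ux : u *m map_mx f (qad x - 1%:M) = (a - 1) *: u.
    by rewrite map_mxB map_mx1 mulmxBr mulmx1 -mulmxA -DV // mulmxA va scalerBl scale1r -scalemxAl.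
  apply/eqP; rewrite -subr_eq0; apply: contraT => a1.
  (* If [a] differs from 1, [u] is a multiple of its image under [qad x - 1], so it descends through
     the whole flag to [U c = 0]. *)
  have uU j : (u <= map_mx f (U j))%MS.
    elim: j => [|j IHj].
      rewrite -(eqmx_scale u a1) -ux; have : (u <= map_mx f W)%MS by rewrite /u /V mulmxA submxMl.
      move=> /submxP[w ->]; rewrite -mulmxA -map_mxM; apply: mulmx_sub; rewrite map_submx.
      apply/row_subP => k; rewrite row_mul; have [y Gy ->] := WG k; exact: WU0.
    rewrite -(eqmx_scale u a1) -ux; have /submxP[w ->] := IHj.
    by rewrite -mulmxA -map_mxM; apply: mulmx_sub; rewrite map_submx; exact: UU.
  by move: (uU c); rewrite Uc map_mx0 => /submx0null u00; rewrite u00 eqxx in u0.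
have -> : Fitting G = F.
  apply/seteqP; split.
    apply: generated_min => // x [N [nN nilN] Nx]; exact: subF nN nilN x Nx.
  by move=> x Fx; apply: sub_generated; exists F.
split=> //.
  apply: quotient_abelianP nF _ => x y Gx Gy; split; first exact: subgroupR.
  by move=> i; exact: diagR.
apply: quotient_torsion_freeP sG nF _ => x n Gx [_ Dxn]; split=> // i.
(* Diagonal entries are eigenvalues, so uniqueness of roots compares [x] with the identity, whose
   eigenvalue is 1. *)
have ex : eigenvalue (map_mx idfun (D x)) (D x i i).
  by rewrite map_mx_id_in //; apply: trig_eigenvalue; exact: trD.
have e1 : eigenvalue (map_mx idfun (D 1%g)) 1.
  rewrite map_mx_id_in // -(diag1 i); apply: trig_eigenvalue; apply: trD; exact: subgroup1.
apply: (rep_root_unique DP Gx (subgroup1 sG) ex e1 (n := n)).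
rewrite expr1n -(Dxn i); elim: n {Dxn} => [|n IHn]; first by rewrite expr1.
by rewrite exprS IHn [in RHS]expgS diagM //; exact: subgroupX.
Qed.

End FittingSubgroup.

Local Close Scope ring_scope.

Theorem theorem2p6 (p : nat) (U : topologicalGroupType) (G : set U) :
  prime p -> is_uniform_pro_p p U -> is_subgroup G -> virtually_solvable G ->
  [/\ is_nilpotent (Fitting G),
      quotient_abelian G (Fitting G) &
      quotient_torsion_free G (Fitting G)].
Proof.
move=> p_pr unifU sG vsG.
have [d [L [A logP]]] := padic_log_exists p_pr (uniform_filtration_lower_p_series p_pr unifU).
exact: (@Fitting_structure _ _ _ _ _ _ logP).
Qed.
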